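(* Let $X$ be a transitive $\mathbb{SO}(d)$-metric-space and assume that the action of $\mathbb{SO}(d)$ on $X$ is $L$-Lipschitz for some $L>0$. Then for any measurable $A\subseteq X$ and any $\epsilon>0$, \[ \mu_X(A_\epsilon)\ge 1-e^{-\frac{(d-2)\epsilon^2(\mu_X(A))^2}{8L^2}}. \]
   Context: $\mathbb{SO}(d)$ is the group of $d\times d$ orthogonal matrices with determinant $1$, with the metric induced by the Frobenius norm, and $\mu$ is its Haar probability measure. A metric space $(X,d)$ is an $\mathbb{SO}(d)$-metric-space if there is a map $(U,\mathbf{x})\mapsto U\mathbf{x}$ from $\mathbb{SO}(d)\times X$ to $X$ with $V(U\mathbf{x})=(VU)\mathbf{x}$, $I\mathbf{x}=\mathbf{x}$ and $d(U\mathbf{x},U\mathbf{y})=d(\mathbf{x},\mathbf{y})$ for all $U,V\in\mathbb{SO}(d)$, $\mathbf{x},\mathbf{y}\in X$. It is transitive if for all $\mathbf{x},\mathbf{y}\in X$ there is $U\in\mathbb{SO}(d)$ with $\mathbf{y}=U\mathbf{x}$. The action is $L$-Lipschitz if for every $\mathbf{x}\in X$ the map $U\mapsto U\mathbf{x}$ from $\mathbb{SO}(d)$ to $X$ is $L$-Lipschitz. For transitive $X$, the Haar measure $\mu_X$ is defined by $\mu_X(A)=\mu(\{U\in\mathbb{SO}(d):U\mathbf{x}\in A\})$ for any fixed $\mathbf{x}\in X$ (independent of the choice of $\mathbf{x}$). For $A\subseteq X$, $d(A,\mathbf{x})=\inf_{\mathbf{y}\in A}d(\mathbf{y},\mathbf{x})$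 and $A_\epsilon=\{\mathbf{x}\in X: d(A,\mathbf{x})\le\epsilon\}$. *)

(* Defs.v *)
From HB Require Import structures.
From mathcomp Require Import all_boot all_order all_algebra.
From mathcomp Require Import all_classical all_reals all_analysis.
Set Implicit Arguments. Unset Strict Implicit. Unset Printing Implicit Defensive.
Import Order.TTheory GRing.Theory Num.Theory.
Local Open Scope classical_set_scope.
Local Open Scope ring_scope.

Definition frob_dist (R : realType) (d : nat) (A B : 'M[R]_d) : R :=
  Num.sqrt (\sum_(i < d) \sum_(j < d) (A i j - B i j) ^+ 2).

Definition SO (R : realType) (d : nat) : set 'M[R]_d :=
  [set U | U^T *m U = 1%:M /\ \det U = 1].

Definition dist_open (T : Type) (R : realType) (dist : T -> T -> R)
  : set (set T) :=
  [set S | forall x, S x -> exists2 e : R, 0 < e &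
     forall y, dist x y < e -> S y].

(* Alias of the square matrix type carrying a pointed structure (point 0),
   needed for the generated sigma-algebra construction. *)
Definition Mat (R : realType) (d : nat) := 'M[R]_d.
HB.instance Definition _ (R : realType) (d : nat) :=
  Choice.copy (Mat R d) 'M[R]_d.
HB.instance Definition _ (R : realType) (d : nat) :=
  isPointed.Build (Mat R d) (0%R : 'M[R]_d).

Definition frob_open (R : realType) (d : nat) : set (set (Mat R d)) :=
  dist_open (@frob_dist R d).

Notation MBorel R d := (g_sigma_algebraType (@frob_open R d)).

Definition is_metric (T : Type) (R : realType) (dist : T -> T -> R) : Prop :=
  [/\ forall x y, 0 <= dist x y,
      forall x y, dist x y = 0 <-> x = y,
      forall x y, dist x y = dist y x &
      forall x y z, dist x z <= dist x y + dist y z].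

(* (X, dist) is an SO(d)-metric-space via act (only the restriction of act
   to SO(d) is relevant). *)
Definition SO_metric_space (R : realType) (d : nat) (X : Type)
  (dist : X -> X -> R) (act : 'M[R]_d -> X -> X) : Prop :=
  [/\ forall U V x, @SO R d U -> @SO R d V -> act V (act U x) = act (V *m U) x,
      forall x, act 1%:M x = x &
      forall U x y, @SO R d U -> dist (act U x) (act U y) = dist x y].

Definition SO_transitive (R : realType) (d : nat) (X : Type)
  (act : 'M[R]_d -> X -> X) : Prop :=
  forall x y, exists2 U, @SO R d U & y = act U x.

Definition SO_Lipschitz_action (R : realType) (d : nat) (X : Type)
  (dist : X -> X -> R) (act : 'M[R]_d -> X -> X) (L : R) : Prop :=
  forall x U V, @SO R d U -> @SO R d V ->
    dist (act U x) (act V x) <= L * frob_dist U V.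

Definition is_Haar_SO (R : realType) (d : nat)
  (mu : probability (MBorel R d) R) : Prop :=
  mu (@SO R d) = 1%E /\
  forall V, @SO R d V -> forall S : set (MBorel R d), measurable S ->
    mu ((fun U : 'M[R]_d => V *m U) @^-1` S) = mu S.

Definition mu_X (R : realType) (d : nat) (X : Type)
  (mu : probability (MBorel R d) R) (act : 'M[R]_d -> X -> X) (x0 : X)
  (A : set X) : \bar R :=
  mu [set U : MBorel R d | @SO R d U /\ A (act U x0)].

(* d(A, x) = inf_{y in A} d(y, x)  (with inf of the empty set = +oo). *)
Definition dist_set (R : realType) (X : Type) (dist : X -> X -> R)
  (A : set X) (x : X) : \bar R :=
  ereal_inf [set (dist y x)%:E | y in A].

Definition enlarge (R : realType) (X : Type) (dist : X -> X -> R)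
  (A : set X) (eps : R) : set X :=
  [set x | (dist_set dist A x <= eps%:E)%E].

(* Main.v *)
(* Discrete Bakry-Emery argument.  A Lipschitz function F on SO(n) is mollified
   to pot c U = E_V [c V exp (b <U, V>)].  Average pot c over left rotations by a
   small angle t in the coordinate planes (i, j), i.e. run a short random walk
   with the discretised Laplacian.  One step multiplies the sup q of |grad|^2 by
   1 / (1 + kap t^2) up to O(t^3), kap = (n - 2) / n^2: the antisymmetric part of
   the Hessian in the frame U |-> X_a U consists of the derivatives along the
   brackets [X_a, X_b], whose squares sum to 4 (n - 2) |grad|^2.  One step also
   costs a factor exp (lam^2 t^2 q / (2 n^2)) in E exp (lam pot c).  Summing the
   geometric series while the walk drives pot c to its mean gives
   E exp (lam (F - E F)) <= exp (2 lam^2 L^2 / (n - 2)), and Chernoff's bound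
   applied to F = min (d(A, U x), eps), whose mean is at most eps (1 - mu(A)),
   concludes. *)
Require Import Defs.
From HB Require Import structures.
From mathcomp Require Import all_boot all_order all_algebra.
From mathcomp Require Import all_classical all_reals all_analysis.
From mathcomp Require Import measurable_realfun ring lra.
Set Implicit Arguments. Unset Strict Implicit. Unset Printing Implicit Defensive.
Import Order.TTheory GRing.Theory Num.Theory.
Local Open Scope classical_set_scope.
Local Open Scope ring_scope.

(** * The Frobenius inner product and norm, and their invariance under SO(n) *)

Section Frobenius.
Context {R : realType}.

(** A limit over many steps needs Taylor remainders that do not degrade along the walk, and [pot]
    provides them: every derivative of [pot c] falls on the kernel, so remainders see [c] only
    through a bound on |c|. As <W U, W V> = <U, V> and Haar measure is left invariant, rotating the
    argument of [pot c] amounts to rotating [c]. A step therefore averages the density, keeps its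
    bound, and one constant serves all steps. First-order expansions suffice: the exact average is
    passed on to the next step, and only a variance, known up to O(t^3) from first-order data, is
    estimated.

    Planes are indexed by all n^2 ordered pairs: each plane occurs twice and the n diagonal pairs
    are idle. Hence |grad|^2 means |G - G^T|^2, at most 4 l^2 for an l-Lipschitz function, and the
    bound lam^2 q / (2 (n - 2)) becomes 2 lam^2 l^2 / (n - 2).

    Over k steps of angle t the errors add up to k t^3, while the contraction needs k t^2 large; t =
    j^-4 and k = j^10 achieve both as j grows. *)

Definition ip {m n : nat} (A B : 'M[R]_(m, n)) : R := \tr (A^T *m B).

Definition nrm {m n : nat} (A : 'M[R]_(m, n)) : R := Num.sqrt (ip A A).

Lemma ipE m n (A B : 'M[R]_(m, n)) :
  ip A B = \sum_i \sum_j A i j * B i j.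
Proof.
rewrite /ip /mxtrace exchange_big /=; apply: eq_bigr => j _.
by rewrite mxE; apply: eq_bigr => i _; rewrite mxE.
Qed.

Lemma ipC m n (A B : 'M[R]_(m, n)) : ip A B = ip B A.
Proof. by rewrite /ip -mxtrace_tr trmx_mul trmxK. Qed.

Lemma ipDl m n (A B C : 'M[R]_(m, n)) : ip (A + B) C = ip A C + ip B C.
Proof. by rewrite /ip linearD /= mulmxDl linearD. Qed.

Lemma ipZl m n a (A C : 'M[R]_(m, n)) : ip (a *: A) C = a * ip A C.
Proof. by rewrite /ip linearZ /= -scalemxAl linearZ. Qed.

Lemma ipDr m n (A B C : 'M[R]_(m, n)) : ip C (A + B) = ip C A + ip C B.
Proof. by rewrite ipC ipDl (ipC A) (ipC B). Qed.

Lemma ipZr m n a (A C : 'M[R]_(m, n)) : ip C (a *: A) = a * ip C A.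
Proof. by rewrite ipC ipZl ipC. Qed.

Lemma ipNl m n (A C : 'M[R]_(m, n)) : ip (- A) C = - ip A C.
Proof. by rewrite -scaleN1r ipZl mulN1r. Qed.

Lemma ipNr m n (A C : 'M[R]_(m, n)) : ip C (- A) = - ip C A.
Proof. by rewrite ipC ipNl ipC. Qed.

Lemma ipBl m n (A B C : 'M[R]_(m, n)) : ip (A - B) C = ip A C - ip B C.
Proof. by rewrite ipDl ipNl. Qed.

Lemma ipBr m n (A B C : 'M[R]_(m, n)) : ip C (A - B) = ip C A - ip C B.
Proof. by rewrite ipDr ipNr. Qed.

Lemma ip0l m n (C : 'M[R]_(m, n)) : ip 0 C = 0.
Proof. by rewrite -[0](scale0r (0 : 'M[R]_(m, n))) ipZl mul0r. Qed.

Lemma ip_mull m n p (M : 'M[R]_(m, p)) (A : 'M[R]_(p, n))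
    (B : 'M[R]_(m, n)) :
  ip (M *m A) B = ip A (M^T *m B).
Proof. by rewrite /ip trmx_mul mulmxA. Qed.

Lemma ip_mulr m n p (M : 'M[R]_(p, n)) (A : 'M[R]_(m, p))
    (B : 'M[R]_(m, n)) :
  ip (A *m M) B = ip A (B *m M^T).
Proof. by rewrite /ip trmx_mul -mulmxA mxtrace_mulC mulmxA. Qed.

Lemma ip_tr m n (A B : 'M[R]_(m, n)) : ip A^T B^T = ip A B.
Proof. by rewrite /ip trmxK mxtrace_mulC -[LHS]mxtrace_tr trmx_mul trmxK. Qed.

Lemma ip_deltal m n (i : 'I_m) (j : 'I_n) (M : 'M[R]_(m, n)) :
  ip (delta_mx i j) M = M i j.
Proof.
rewrite ipE (bigD1 i) //= (bigD1 j) //= !big1 ?addr0.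
- by rewrite mxE !eqxx mul1r.
- by move=> k /negbTE nk; rewrite big1 // => l _; rewrite mxE nk mul0r.
- by move=> l /negbTE nl; rewrite mxE nl andbF mul0r.
Qed.

Lemma ipxx_ge0 m n (A : 'M[R]_(m, n)) : 0 <= ip A A.
Proof.
by rewrite ipE sumr_ge0 // => i _; rewrite sumr_ge0 // => j _; rewrite -expr2 sqr_ge0.
Qed.

Lemma ipxx_eq0 m n (A : 'M[R]_(m, n)) : ip A A = 0 -> A = 0.
Proof.
move=> A0; apply/matrixP => i j; rewrite mxE; apply/eqP.
rewrite -sqrf_eq0; apply/eqP.
move/eqP: A0; rewrite ipE psumr_eq0; last first.
  by move=> k _; rewrite sumr_ge0 // => l _; rewrite -expr2 sqr_ge0.
move/allP/(_ i (mem_index_enum _))/eqP/eqP; rewrite psumr_eq0; last first.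
  by move=> l _; rewrite -expr2 sqr_ge0.
by move/allP/(_ j (mem_index_enum _))/eqP.
Qed.

Lemma ip_sqr_le m n (A B : 'M[R]_(m, n)) : ip A B ^+ 2 <= ip A A * ip B B.
Proof.
have [/ipxx_eq0 ->|nzB] := eqVneq (ip B B) 0.
  by rewrite ipC ip0l expr0n /= mulr_ge0 ?ipxx_ge0.
have pB : 0 < ip B B by rewrite lt0r nzB ipxx_ge0.
have := ipxx_ge0 (ip B B *: A - ip A B *: B).
rewrite !(ipBl, ipBr, ipZl, ipZr) (ipC B A).
move: (ip A A) (ip A B) (ip B B) pB => a x b pB H.
rewrite -subr_ge0 -(pmulr_rge0 _ pB); lra.
Qed.

Lemma nrm_ge0 m n (A : 'M[R]_(m, n)) : 0 <= nrm A.
Proof. exact: sqrtr_ge0. Qed.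

Lemma nrm_sqr m n (A : 'M[R]_(m, n)) : nrm A ^+ 2 = ip A A.
Proof. by rewrite sqr_sqrtr ?ipxx_ge0. Qed.

Lemma ip_le_nrm m n (A B : 'M[R]_(m, n)) : `|ip A B| <= nrm A * nrm B.
Proof.
rewrite -(@ler_pXn2r _ 2) ?nnegrE ?mulr_ge0 ?nrm_ge0 //.
by rewrite real_normK ?num_real // exprMn !nrm_sqr ip_sqr_le.
Qed.

Lemma nrmZ m n a (A : 'M[R]_(m, n)) : nrm (a *: A) = `|a| * nrm A.
Proof. by rewrite /nrm ipZl ipZr mulrA -expr2 sqrtrM ?sqr_ge0 // sqrtr_sqr. Qed.

Lemma nrmN m n (A : 'M[R]_(m, n)) : nrm (- A) = nrm A.
Proof. by rewrite -scaleN1r nrmZ normrN1 mul1r. Qed.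

Lemma nrmD m n (A B : 'M[R]_(m, n)) : nrm (A + B) <= nrm A + nrm B.
Proof.
rewrite -(@ler_pXn2r _ 2) ?nnegrE ?addr_ge0 ?nrm_ge0 //.
rewrite sqrrD !nrm_sqr !(ipDl, ipDr) (ipC B A).
have := le_trans (ler_norm _) (ip_le_nrm A B).
move: (ip A B) (nrm A * nrm B) (ip A A) (ip B B) => x y a b; lra.
Qed.

Lemma nrmB m n (A B : 'M[R]_(m, n)) : nrm (A - B) <= nrm A + nrm B.
Proof. by rewrite -(nrmN B) nrmD. Qed.

Lemma nrmM m n p (A : 'M[R]_(m, p)) (B : 'M[R]_(p, n)) :
  nrm (A *m B) <= nrm A * nrm B.
Proof.
rewrite -(@ler_pXn2r _ 2) ?nnegrE ?mulr_ge0 ?nrm_ge0 // exprMn !nrm_sqr.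
have -> : ip B B = \sum_j ip (col j B) (col j B).
  rewrite ipE exchange_big; apply: eq_bigr => j _; rewrite ipE.
  by apply: eq_bigr => i _; rewrite big_ord1 !mxE.
have -> : ip A A = \sum_i ip (row i A)^T (row i A)^T.
  rewrite ipE; apply: eq_bigr => j _; rewrite ipE.
  by apply: eq_bigr => i _; rewrite big_ord1 !mxE.
rewrite ipE big_distrlr /=; apply: ler_sum => i _; apply: ler_sum => j _.
apply: le_trans (ip_sqr_le _ _); rewrite -expr2 le_eqVlt; apply/orP; left.
apply/eqP; congr (_ ^+ 2); rewrite mxE ipE; apply: eq_bigr => k _.
by rewrite big_ord1 !mxE.
Qed.

Lemma frob_distE n (A B : 'M[R]_n) : frob_dist A B = nrm (A - B).
Proof.
rewrite /frob_dist /nrm ipE; congr Num.sqrt.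
by apply: eq_bigr => i _; apply: eq_bigr => j _; rewrite !mxE expr2.
Qed.

Lemma SO_mul n (U V : 'M[R]_n) : SO U -> SO V -> SO (U *m V).
Proof.
move=> [oU dU] [oV dV]; split; last by rewrite det_mulmx dU dV mulr1.
by rewrite trmx_mul mulmxA -(mulmxA V^T) oU mulmx1.
Qed.

Lemma SO_mulmx_tr n (U : 'M[R]_n) : SO U -> U *m U^T = 1%:M.
Proof. by move=> [oU _]; apply: mulmx1C. Qed.

Lemma SO_tr n (U : 'M[R]_n) : SO U -> SO U^T.
Proof. by move=> sU; split; rewrite ?trmxK ?SO_mulmx_tr ?det_tr //; case: sU. Qed.

Lemma SO_one n : SO (1%:M : 'M[R]_n).
Proof. by split; rewrite ?trmx1 ?mulmx1 ?det1. Qed.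

Lemma nrm_SOl m n (U : 'M[R]_n) (A : 'M[R]_(n, m)) : SO U -> nrm (U *m A) = nrm A.
Proof. by move=> [oU _]; rewrite /nrm ip_mull mulmxA oU mul1mx. Qed.

Lemma nrm_SOr m n (U : 'M[R]_n) (A : 'M[R]_(m, n)) : SO U -> nrm (A *m U) = nrm A.
Proof. by move=> sU; rewrite /nrm ip_mulr -mulmxA SO_mulmx_tr // mulmx1. Qed.

Lemma ip_SO n (U : 'M[R]_n) : SO U -> ip U U = n%:R.
Proof. by move=> [oU _]; rewrite /ip oU mxtrace1. Qed.

Lemma nrm_SO_le n (U : 'M[R]_n) : SO U -> nrm U <= n%:R.
Proof.
move=> sU; rewrite -(@ler_pXn2r _ 2) ?nnegrE ?nrm_ge0 ?ler0n //.
by rewrite nrm_sqr ip_SO // -natrX ler_nat -mulnn; case: (n) => // k; rewrite leq_pmulr.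
Qed.

Lemma ip_SO_le n (A U V : 'M[R]_n) :
  SO U -> SO V -> `|ip (A *m U) V| <= nrm A * n%:R.
Proof.
move=> sU sV; apply: le_trans (ip_le_nrm _ _) _; rewrite nrm_SOr //.
by rewrite ler_wpM2l ?nrm_ge0 ?nrm_SO_le.
Qed.

End Frobenius.

(** * Generators of so(n), plane rotations, and the bracket identity *)

Section Generators.
Context {R : realType} {n : nat}.
Implicit Types (M N S U : 'M[R]_n) (p q : 'I_n * 'I_n) (s t : R).

Definition Xgen p : 'M[R]_n := delta_mx p.1 p.2 - delta_mx p.2 p.1.

Lemma Xgen_tr p : (Xgen p)^T = - Xgen p.
Proof. by rewrite /Xgen linearB /= !trmx_delta opprB. Qed.

Lemma Xgen_swap p : Xgen (p.2, p.1) = - Xgen p.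
Proof. by rewrite /Xgen opprB. Qed.

Lemma Xgen_cube p : Xgen p *m Xgen p *m Xgen p = - Xgen p.
Proof.
rewrite /Xgen; case: p => i j /=.
have [->|nij] := eqVneq i j; first by rewrite subrr mulmx0 oppr0.
rewrite !(mulmxBl, mulmxBr) !mul_delta_mx_cond !eqxx (eq_sym j i) (negbTE nij) /=.
rewrite !mulr0n !mulr1n !(mul0mx, mulmx0, subr0, sub0r, mulmxBl, mulNmx).
rewrite !mul_delta_mx_cond !eqxx (eq_sym j i) (negbTE nij) /= !mulr0n !mulr1n.
by apply/matrixP => a b; rewrite !mxE; ring.
Qed.

(** Rodrigues form of exp (t X) for X = [Xgen p], valid because X^3 = -X. It covers a diagonal pair
    too, where X = 0 and the rotation is the identity. *)
Definition givens p t : 'M[R]_n :=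
  1%:M + sin t *: Xgen p + (1 - cos t) *: (Xgen p *m Xgen p).

Lemma givensD p s t : givens p (s + t) = givens p s *m givens p t.
Proof.
rewrite /givens sinD cosD.
have X3 := Xgen_cube p; move: (Xgen p) X3 => X X3.
have X3' : X *m (X *m X) = - X by rewrite mulmxA.
have X4 : X *m X *m (X *m X) = - (X *m X) by rewrite mulmxA X3 mulNmx.
rewrite !(mulmxDl, mulmxDr, mulmx1, mul1mx) -!scalemxAl -!scalemxAr X3 X3' X4.
move: (X *m X) => Y; apply/matrixP => i j; rewrite !mxE.
by case: (i == j); rewrite /= ?mulr1n ?mulr0n; ring.
Qed.

Lemma givens0 p : givens p 0 = 1%:M.
Proof. by rewrite /givens sin0 cos0 scale0r subrr scale0r !addr0. Qed.

Lemma givens_tr p t : (givens p t)^T = givens p (- t).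
Proof.
rewrite /givens sinN cosN; move: (Xgen p) (Xgen_tr p) => X XT.
rewrite !linearD /= !linearZ /= trmx1 trmx_mul XT.
by rewrite !(mulmxN, mulNmx, opprK, scalerN, scaleNr).
Qed.

Lemma SO_givens p t : SO (givens p t).
Proof.
have o s : (givens p s)^T *m givens p s = 1%:M.
  by rewrite givens_tr -givensD addNr givens0.
(* The rotation is the square of its half-angle rotation g, so its determinant is det (g^T g) =
   1. *)
split=> //; rewrite [t]splitr givensD det_mulmx -{1}det_tr -det_mulmx.
by rewrite o det1.
Qed.

Lemma ip_Xgen p M : ip (Xgen p) M = M p.1 p.2 - M p.2 p.1.
Proof. by rewrite /Xgen ipBl !ip_deltal. Qed.

Lemma sum_ip_Xgen_sqr M :
  \sum_p (ip (Xgen p) M) ^+ 2 = ip (M - M^T) (M - M^T).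
Proof.
rewrite ipE -(pair_bigA _ (fun i j => (ip (Xgen (i, j)) M) ^+ 2)) /=.
by apply: eq_bigr => i _; apply: eq_bigr => j _; rewrite ip_Xgen /= !mxE expr2.
Qed.

(** Conjugating the frame by U conjugates M - M^T by U^T, which preserves its Frobenius norm: the
    gradient length does not depend on the orthogonal frame. *)
Lemma sum_ip_conj_Xgen_sqr U M : SO U ->
  \sum_p (ip (U *m Xgen p *m U^T) M) ^+ 2 = \sum_p (ip (Xgen p) M) ^+ 2.
Proof.
move=> sU; under eq_bigr do rewrite ip_mulr trmxK ip_mull.
rewrite !sum_ip_Xgen_sqr; apply/eqP; rewrite -!nrm_sqr; apply/eqP; congr (_ ^+ 2).
rewrite !trmx_mul trmxK -(nrm_SOr (M - M^T) sU) -(nrm_SOl (_ *m U) (SO_tr sU)).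
by rewrite mulmxBl mulmxBr !mulmxA.
Qed.

Lemma sum_delta_mul (f : 'I_n -> R) j : \sum_k (j == k)%:R * f k = f j.
Proof.
rewrite (bigD1 j) //= eqxx mul1r big1 ?addr0 // => k.
by rewrite eq_sym => /negbTE ->; rewrite mul0r.
Qed.

Let bracket i j k l M : ip (Xgen (i, j) *m Xgen (k, l) - Xgen (k, l) *m Xgen (i, j)) M
  = let N := M - M^T in
  (j == k)%:R * N i l - (j == l)%:R * N i k
  - (i == k)%:R * N j l + (i == l)%:R * N j k.
Proof.
rewrite /= /Xgen !(mulmxBl, mulmxBr) !mul_delta_mx_cond /= !mxE.
rewrite (eq_sym l i) (eq_sym l j) (eq_sym k i) (eq_sym k j).
rewrite !(ipBl, ipNl).
by do 4 case: (_ == _); rewrite /= ?mulr1n ?mulr0n ?ip0l ?ip_deltal; ring.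
Qed.

(** On the diagonal i = j the generator is zero, and the last term cancels the contribution 4
    |N_i|^2 left by the first two. *)
Let sum_bracket (N : 'M[R]_n) (i j : 'I_n) : (forall k, N k k = 0) ->
  (forall k l, N k l = - N l k) ->
  \sum_k \sum_l ((j == k)%:R * N i l - (j == l)%:R * N i k
  - (i == k)%:R * N j l + (i == l)%:R * N j k) ^+ 2
  = 2 * \sum_k N i k ^+ 2 + 2 * \sum_k N j k ^+ 2 - 4 * N i j ^+ 2
    - 4 * ((i == j)%:R * \sum_k N i k ^+ 2).
Proof.
move=> N0 Na.
under eq_bigr => k _.
  under eq_bigr => l _.
    (* Kronecker deltas are idempotent, so the square has four plain terms and six cross terms, and
       the sums over k and l collapse. *)
    rewrite (_ : _ ^+ 2 = (j == k)%:R * N i l ^+ 2 + (j == l)%:R * N i k ^+ 2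
      + (i == k)%:R * N j l ^+ 2 + (i == l)%:R * N j k ^+ 2
      + (j == l)%:R * ((j == k)%:R * (- 2 * N i k * N i l))
      + (i == k)%:R * ((j == k)%:R * (- 2 * N i l * N j l))
      + (i == l)%:R * ((j == k)%:R * (2 * N i l * N j k))
      + (j == l)%:R * ((i == k)%:R * (2 * N i k * N j l))
      + (j == l)%:R * ((i == l)%:R * (- 2 * N i k * N j k))
      + (i == l)%:R * ((i == k)%:R * (- 2 * N j l * N j k))); last first.
      by do 4 case: (_ == _); rewrite /=; ring.
    over.
  rewrite !big_split /= -!mulr_sumr !sum_delta_mul; over.
rewrite !big_split /= !sum_delta_mul -!mulr_sumr !N0 (Na j i) (eq_sym j i).
have -> : (i == j)%:R * (\sum_k -2 * N i k * N j k)
  = -2 * ((i == j)%:R * \sum_k N i k ^+ 2).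
  have [<-|_] := eqVneq i j; last by rewrite !mul0r mulr0.
  rewrite !mul1r mulr_sumr; apply: eq_bigr => k _.
  by rewrite -mulrA -expr2.
ring.
Qed.

(** The Casimir identity of the adjoint representation of so(n), up to normalisation the Ricci
    curvature of SO(n), and the source of n - 2: summed over (i, j), the bracket sums yield (2 n + 2
    n - 4 - 4) |N|^2. *)
Lemma sum_ip_bracket_sqr M :
  \sum_p \sum_q (ip (Xgen p *m Xgen q - Xgen q *m Xgen p) M) ^+ 2
  = 4 * (n%:R - 2) * \sum_p (ip (Xgen p) M) ^+ 2.
Proof.
rewrite sum_ip_Xgen_sqr; set N := M - M^T.
have N0 k : N k k = 0 by rewrite !mxE subrr.
have Na k l : N k l = - N l k by rewrite !mxE opprB.
have rN : ip N N = \sum_i \sum_k N i k ^+ 2.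
  by rewrite ipE; apply: eq_bigr => i _; apply: eq_bigr => k _; rewrite expr2.
rewrite -(pair_bigA _ (fun i j =>
  \sum_q (ip (Xgen (i, j) *m Xgen q - Xgen q *m Xgen (i, j)) M) ^+ 2)) /=.
under eq_bigr => i _.
  under eq_bigr => j _.
    rewrite -(pair_bigA _ (fun k l =>
      (ip (Xgen (i, j) *m Xgen (k, l) - Xgen (k, l) *m Xgen (i, j)) M) ^+ 2)) /=.
    under eq_bigr do under eq_bigr do rewrite bracket -/N /=.
    rewrite sum_bracket //; over.
  have -> : \sum_(j < n) (2 * \sum_k N i k ^+ 2 + 2 * \sum_k N j k ^+ 2 -
      4 * N i j ^+ 2 - 4 * ((i == j)%:R * \sum_k N i k ^+ 2))
    = (2 * n%:R - 8) * \sum_k N i k ^+ 2 + 2 * ip N N.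
    rewrite !big_split /= !sumrN -!mulr_sumr sum_delta_mul sumr_const card_ord.
    rewrite -rN -mulr_natl; ring.
  over.
rewrite big_split /= -mulr_sumr -rN sumr_const card_ord -mulr_natl; ring.
Qed.

End Generators.

(** * The Cayley transform of a skew matrix *)

Section Cayley.
Context {R : realType} {n : nat}.

Lemma ip_skew_mull m (S : 'M[R]_n) (B : 'M[R]_(n, m)) : S^T = - S -> ip (S *m B) B = 0.
Proof.
move=> kS; have : ip (S *m B) B = - ip (S *m B) B.
  by rewrite {1}ip_mull kS mulNmx ipNr ipC.
move: (ip _ _) => x; lra.
Qed.

(** S B is orthogonal to B, so |(1 - S) B|^2 = |B|^2 + |S B|^2. Estimates on a Cayley transform can
    thus be checked after multiplication by 1 - S, which clears the inverse. *)
Lemma nrm_one_sub_skew (S B : 'M[R]_n) : S^T = - S -> nrm B <= nrm ((1%:M - S) *m B).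
Proof.
move=> kS; rewrite -(@ler_pXn2r _ 2) ?nnegrE ?nrm_ge0 // !nrm_sqr.
rewrite mulmxBl mul1mx !(ipBl, ipBr) (ipC B) (ip_skew_mull _ kS).
have := ipxx_ge0 (S *m B); lra.
Qed.

Lemma one_sub_skew_unit (S : 'M[R]_n) : S^T = - S -> 1%:M - S \in unitmx.
Proof.
move=> kS; rewrite unitmxE unitfE; apply/negP => /det0P [v nv].
rewrite mulmxBr mulmx1 => /eqP; rewrite subr_eq0 => /eqP vS.
have : ip v v = 0.
  rewrite -ip_tr {1}vS trmx_mul; apply: ip_skew_mull.
  by rewrite trmxK kS opprK.
by move/ipxx_eq0 => v0; rewrite v0 eqxx in nv.
Qed.

(* The Cayley transform of t S / 2 is a curve in SO(n) tangent to S at 1 whose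
   chord is at most the length |t| |S| of the tangent vector. *)
Lemma SO_cayley (S : 'M[R]_n) (t : R) : S^T = - S ->
  exists W : 'M[R]_n, [/\ SO W, nrm (W - 1%:M) <= `|t| * nrm S &
    nrm (W - 1%:M - t *: S) <= t ^+ 2 * nrm S ^+ 2].
Proof.
move=> kS; pose A := (t / 2) *: S.
have kA : A^T = - A by rewrite /A linearZ /= kS scalerN.
have uM := one_sub_skew_unit kA; set M := 1%:M - A in uM.
pose N := 1%:M + A; pose W := invmx M *m N.
have MT : M^T = N by rewrite /M /N linearB /= trmx1 kA opprK.
have MW : M *m W = N by rewrite /W mulmxA mulmxV // mul1mx.
have NM : N *m M = M *m N.
  rewrite /M /N !(mulmxDl, mulmxDr, mulmxN, mulNmx, mulmx1, mul1mx).
  by move: (A *m A) => B; apply/matrixP => i j; rewrite !mxE; ring.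
have WM : W *m M = N.
  by rewrite -[LHS]mul1mx -(mulVmx uM) -mulmxA (mulmxA M) MW NM mulmxA mulVmx // mul1mx.
have tA : t *: S = A + A by rewrite /A -scalerDl -splitr.
have nA : nrm A = `|t| / 2 * nrm S by rewrite /A nrmZ normrM normfV (ger0_norm (_ : 0 <= 2)).
exists W; split.
- split.
    have WN : W^T *m N = M by rewrite -MT -trmx_mul MW -MT trmxK.
    by rewrite -[LHS]mulmx1 -(mulmxV uM) mulmxA -(mulmxA W^T) WM WN mulmxV.
  have := congr1 determinant MW; rewrite det_mulmx -MT det_tr => /eqP.
  rewrite -{2}(mulr1 (\det M)) => /eqP; apply: mulfI.
  by move: uM; rewrite unitmxE unitfE.
- apply: le_trans (nrm_one_sub_skew (W - 1%:M) kA) _; rewrite -/M mulmxBr MW mulmx1.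
  have -> : N - M = t *: S by rewrite tA /N /M; apply/matrixP => i j; rewrite !mxE; ring.
  by rewrite nrmZ.
apply: le_trans (nrm_one_sub_skew (W - 1%:M - t *: S) kA) _.
rewrite -/M !mulmxBr MW mulmx1.
have -> : N - M - M *m (t *: S) = (A + A) *m A.
  rewrite tA /M /N mulmxBl mul1mx mulmxDr mulmxDl !opprB.
  move: (A *m A) => B; apply/matrixP => i j; rewrite !mxE; ring.
apply: le_trans (nrmM _ _) _; rewrite -tA nrmZ nA.
have := mulr_ge0 (sqr_ge0 (`|t|)) (sqr_ge0 (nrm S)); rewrite real_normK ?num_real //.
rewrite -(real_normK (num_real t)); move: (nrm S) `|t| => a b; rewrite !expr2; nra.
Qed.

End Cayley.

(** * Measurable and bounded functions on SO(n) *)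

Section Measurability.
Context {R : realType} {n : nat}.
Local Notation M := (MBorel R n).
Implicit Types (U V W : 'M[R]_n) (f g : 'M[R]_n -> R).

Definition lipschitz_SO f := exists K : R, forall U V,
  SO U -> SO V -> `|f U - f V| <= K * nrm (U - V).

Lemma measurable_frob_open (G : set M) : frob_open G -> measurable G.
Proof. exact: sub_sigma_algebra. Qed.

(** The sigma-algebra comes from the open sets of the full matrix space, while f is controlled on D
    alone. The set f > a is cut out of D by the open set where the McShane extension, the supremum
    over V in D of f V - (|K| + 1) |U - V|, exceeds a; the added 1 makes the slope positive. *)
Lemma measurable_lipschitz_on (D : set M) f (K : R) : measurable D ->
  (forall U V, D U -> D V -> `|f U - f V| <= K * nrm (U - V)) ->
  measurable_fun D (f : M -> R).
Proof.
move=> mD fK; apply: (measurability _ (RGenOInfty.measurableE R)) => //.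
move=> _ [_ [a ->] <-].
pose G : set M := [set U : 'M[R]_n | exists2 V, D V & (`|K| + 1) * nrm (U - V) < f V - a].
have K1 : 0 < `|K| + 1 by rewrite ltr_pwDr.
have -> : D `&` f @^-1` `]a, +oo[%classic = D `&` G.
  apply/seteqP; split => U /= [DU]; rewrite in_itv /= andbT => aU; split=> //.
    by exists U => //; rewrite subrr /nrm ip0l sqrtr0 mulr0 subr_gt0.
  case: aU => V DV; have := fK _ _ DV DU; rewrite -nrmN opprB.
  have := nrm_ge0 (U - V); have := ler_norm K; have := ler_norm (f V - f U).
  move: (nrm _) `|K| `|f V - f U| => x k y; nra.
apply: measurableI => //; apply: measurable_frob_open => U [V DV UV].
exists ((f V - a - (`|K| + 1) * nrm (U - V)) / (`|K| + 1)).
  by rewrite divr_gt0 // subr_gt0.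
move=> W; rewrite frob_distE ltr_pdivlMr // => UW; exists V => //.
have : nrm (W - V) <= nrm (U - W) + nrm (U - V).
  rewrite -(nrmN (U - W)) opprB; apply: le_trans (nrmD _ _).
  by rewrite addrA subrK.
move: UW; move: (nrm (U - W)) (nrm (U - V)) (nrm (W - V)) => x y z; nra.
Qed.

Lemma measurable_entry i j : measurable_fun setT ((fun U => U i j) : M -> R).
Proof.
apply: (@measurable_lipschitz_on _ _ 1) => // U V _ _; rewrite mul1r.
have -> : U i j - V i j = ip (delta_mx i j) (U - V) by rewrite ip_deltal !mxE.
apply: le_trans (ip_le_nrm _ _) _; rewrite -[leRHS]mul1r ler_wpM2r ?nrm_ge0 //.
by rewrite /nrm ip_deltal mxE !eqxx sqrtr1.
Qed.

Lemma measurable_SO : measurable (@SO R n : set M).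
Proof.
pose h U := ip (U^T *m U - 1%:M) (U^T *m U - 1%:M).
have mh : measurable_fun setT (h : M -> R).
  apply: (eq_measurable_fun (fun U : M => \sum_i \sum_j
     ((\sum_k U k i * U k j) - (1%:M : 'M[R]_n) i j) ^+ 2)).
    move=> U _; rewrite /h ipE; apply: eq_bigr => i _; apply: eq_bigr => j _.
    by rewrite !mxE expr2; congr ((_ - _) * (_ - _)); apply: eq_bigr => k _;
       rewrite !mxE.
  apply: measurable_sum => i; apply: measurable_sum => j.
  apply: measurable_funX; apply: measurable_funB => //.
  by apply: measurable_sum => k; apply: measurable_funM; apply: measurable_entry.
have md : measurable_fun setT ((fun U => \det U) : M -> R).
  apply: measurable_sum => s; apply: measurable_funM => //.
  by apply: measurable_prod => i _; apply: measurable_entry.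
have -> : (@SO R n : set M) = h @^-1` [set 0] `&` (fun U : M => \det U) @^-1` [set 1].
  apply/seteqP; split => U /= [oU dU]; split=> //.
    by rewrite /h oU subrr ip0l.
  by move/ipxx_eq0: oU => /eqP; rewrite subr_eq0 => /eqP.
by apply: measurableI; rewrite -[_ @^-1` _]setTI; [apply: mh|apply: md].
Qed.

Lemma lipschitz_SO_measurable f : lipschitz_SO f ->
  measurable_fun (@SO R n : set M) (f : M -> R).
Proof. move=> [K fK]; exact: (measurable_lipschitz_on measurable_SO fK). Qed.

Lemma measurable_mulmxl V : SO V ->
  measurable_fun [set: M] ((fun U : 'M[R]_n => V *m U) : M -> M).
Proof.
move=> sV; apply: (@measurability _ _ M M setT _ (@frob_open R n)) => //.
move=> _ [G oG <-]; rewrite setTI; apply: measurable_frob_open => U GU.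
have [e e0 He] := oG _ GU; exists e => // W UW; apply: He.
by rewrite !frob_distE -mulmxBr nrm_SOl // -frob_distE.
Qed.

(** The class of integrands: it contains the Lipschitz functions, is stable under the operations
    performed below, and guarantees integrability over SO(n). *)
Definition bm f := measurable_fun (@SO R n : set M) (f : M -> R) /\
  exists B : R, forall U, SO U -> `|f U| <= B.

Lemma nrm_sub_SO_le U V : SO U -> SO V -> nrm (U - V) <= 2 * n%:R.
Proof.
move=> sU sV; apply: le_trans (nrmB _ _) _.
by rewrite mulrDl mul1r lerD // nrm_SO_le.
Qed.

Lemma lipschitz_SO_bm f : lipschitz_SO f -> bm f.
Proof.
move=> lf; split; first exact: lipschitz_SO_measurable.
have [K fK] := lf; exists (`|f 1%:M| + `|K| * (2 * n%:R)) => U sU.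
rewrite -(subrK (f 1%:M) (f U)) addrC; apply: le_trans (ler_normD _ _) _.
rewrite lerD2l; apply: le_trans (fK _ _ sU (SO_one _)) _.
apply: le_trans (ler_wpM2r (nrm_ge0 _) (ler_norm K)) _.
by rewrite ler_wpM2l // nrm_sub_SO_le //; apply: SO_one.
Qed.

Lemma bm_cst (a : R) : bm (fun=> a).
Proof. by split => //; exists `|a|. Qed.

Lemma bmD f g : bm f -> bm g -> bm (fun U => f U + g U).
Proof.
move=> [mf [B fB]] [mg [C gC]]; split; first exact: measurable_funD.
by exists (B + C) => U sU; rewrite (le_trans (ler_normD _ _)) // lerD ?fB ?gC.
Qed.

Lemma bmM f g : bm f -> bm g -> bm (fun U => f U * g U).
Proof.
move=> [mf [B fB]] [mg [C gC]]; split; first exact: measurable_funM.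
by exists (B * C) => U sU; rewrite normrM ler_pM ?fB ?gC.
Qed.

Lemma bmZ (a : R) f : bm f -> bm (fun U => a * f U).
Proof. by move=> bf; apply: bmM => //; apply: bm_cst. Qed.

Lemma bmB f g : bm f -> bm g -> bm (fun U => f U - g U).
Proof.
move=> bf bg; have := bmD bf (bmZ (-1) bg); congr bm.
by apply/funext => U; rewrite mulN1r.
Qed.

Lemma bm_exp f : bm f -> bm (fun U => expR (f U)).
Proof.
move=> [mf [B fB]]; split; first exact: measurableT_comp.
exists (expR B) => U sU; rewrite ger0_norm ?expR_ge0 // ler_expR.
exact: le_trans (ler_norm _) (fB _ sU).
Qed.

Lemma bm_norm f : bm f -> bm (fun U => `|f U|).
Proof.
move=> [mf [B fB]]; split; first exact: measurableT_comp.
by exists B => U sU; rewrite normr_id fB.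
Qed.

Lemma bm_sum (I : Type) (r : seq I) (F : I -> 'M[R]_n -> R) :
  (forall i, bm (F i)) -> bm (fun U => \sum_(i <- r) F i U).
Proof.
move=> bF; elim: r => [|i r IH].
  rewrite (_ : (fun U => _) = fun=> 0); first exact: bm_cst.
  by apply/funext => U; rewrite big_nil.
have := bmD (bF i) IH; congr bm.
by apply/funext => U; rewrite big_cons.
Qed.

Lemma bm_mulmxl V f : SO V -> bm f -> bm (fun U => f (V *m U)).
Proof.
move=> sV [mf [B fB]]; split; last by exists B => U sU; rewrite fB //; apply: SO_mul.
apply: (@measurable_comp _ _ _ _ _ _ (@SO R n : set M) (f : M -> R) _
  ((fun U : 'M[R]_n => V *m U) : M -> M)) => //.
- exact: measurable_SO.
- by move=> _ [U sU <-]; apply: SO_mul.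
- by apply: measurable_funTS; apply: measurable_mulmxl.
Qed.

Lemma bm_ip (S : 'M[R]_n) : bm (fun V => ip S V).
Proof.
apply: lipschitz_SO_bm; exists (nrm S) => U V _ _.
by rewrite -ipBr ip_le_nrm.
Qed.

Lemma bm_indic (S : set M) : measurable S -> bm (\1_S : M -> R).
Proof.
move=> mS; split; first by apply: measurable_funTS; apply: measurable_indic.
by exists 1 => U _; rewrite indicE; case: (_ \in _); rewrite ?normr1 ?normr0.
Qed.

End Measurability.

(** * Haar means over SO(n) *)

Section Mean.
Context {R : realType} {n : nat}.
Local Notation M := (MBorel R n).
Variables (mu : probability M R) (HHaar : is_Haar_SO mu).
Implicit Types (U V W : 'M[R]_n) (f g : 'M[R]_n -> R).

Definition mean f : R := \int[mu]_(U in (@SO R n : set M)) f U.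

Lemma bm_integrable f : bm f ->
  mu.-integrable (@SO R n : set M) (EFin \o (f : M -> R)).
Proof.
move=> [mf [B fB]]; apply: measurable_bounded_integrable => //.
- exact: measurable_SO.
- apply: (@le_lt_trans _ _ 1%E); last exact: ltry.
  by rewrite le_eqVlt; apply/orP; left; apply/eqP; exact: HHaar.1.
exists B; split; first exact: num_real.
by move=> x Bx U /= sU; apply: le_trans (fB _ sU) (ltW Bx).
Qed.

Lemma eq_mean f g : (forall U, SO U -> f U = g U) -> mean f = mean g.
Proof. by move=> fg; apply: eq_Rintegral => U /set_mem /fg. Qed.

Lemma mean_cst (a : R) : mean (fun=> a) = a.
Proof.
rewrite /mean Rintegral_cst; last exact: measurable_SO.
by rewrite -[RHS]mulr1; congr (_ * _); exact: (congr1 fine HHaar.1).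
Qed.

Lemma meanD f g : bm f -> bm g -> mean (fun U => f U + g U) = mean f + mean g.
Proof.
by move=> bf bg; apply: RintegralD; [apply: measurable_SO|apply: bm_integrable..].
Qed.

Lemma meanZ (a : R) f : bm f -> mean (fun U => a * f U) = a * mean f.
Proof.
by move=> bf; apply: RintegralZl; [apply: measurable_SO|apply: bm_integrable].
Qed.

Lemma meanB f g : bm f -> bm g -> mean (fun U => f U - g U) = mean f - mean g.
Proof.
by move=> bf bg; apply: RintegralB; [apply: measurable_SO|apply: bm_integrable..].
Qed.

Lemma le_mean f g : bm f -> bm g -> (forall U, SO U -> f U <= g U) ->
  mean f <= mean g.
Proof.
by move=> bf bg fg; apply: le_Rintegral => //; [apply: measurable_SO|apply: bm_integrable..].
Qed.

Lemma mean_sum (I : Type) (r : seq I) (F : I -> 'M[R]_n -> R) :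
  (forall i, bm (F i)) ->
  mean (fun U => \sum_(i <- r) F i U) = \sum_(i <- r) mean (F i).
Proof.
move=> bF; elim: r => [|i r IH].
  by rewrite big_nil -[RHS]mean_cst; apply: eq_mean => U _; rewrite big_nil.
rewrite big_cons -IH -meanD //; last exact: bm_sum.
by apply: eq_mean => U _; rewrite big_cons.
Qed.

Lemma mean_norm_le f (B : R) : bm f -> (forall U, SO U -> `|f U| <= B) ->
  `|mean f| <= B.
Proof.
move=> bf fB; apply: le_trans (le_normr_Rintegral _ _) _.
- exact: measurable_SO.
- exact: bm_integrable.
rewrite -[leRHS](mean_cst B); apply: le_mean => //; first exact: bm_norm.
exact: bm_cst.
Qed.

Lemma mean_indic (S : set M) : measurable S -> S `<=` (@SO R n : set M) ->
  mean (\1_S : M -> R) = fine (mu S).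
Proof.
move=> mS SS; rewrite /mean /Rintegral integral_indic //; last exact: measurable_SO.
by rewrite setIidl.
Qed.

Lemma mean_mulmxl V f : SO V -> bm f -> mean (fun U => f (V *m U)) = mean f.
Proof.
move=> sV [mf [B fB]].
have mV := measurable_mulmxl sV.
have mS := @measurable_SO R n.
rewrite /mean [LHS]Rintegral_mkcond [RHS]Rintegral_mkcond /Rintegral; congr fine.
(* Both integrands are extended by zero off SO(n), where f is arbitrary; the extension commutes with
   V because V U lies in SO(n) exactly when U does. *)
set fS := patch _ _ _; set gS := patch _ _ _.
have mfT : measurable_fun [set: M] (EFin \o gS).
  by apply/measurable_EFinP/(measurable_restrictT _ mS).
have E (U : M) : fS U = gS (V *m (U : 'M[R]_n)).
  rewrite /fS /gS !patchE; have -> : (U \in (@SO R n : set M)) =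
     ((V *m (U : 'M[R]_n) : M) \in (@SO R n : set M)) => //.
  apply/idP/idP => /set_mem sU; apply/mem_set; first exact: SO_mul.
  have -> : (U : 'M[R]_n) = V^T *m (V *m (U : 'M[R]_n)).
    by case: sV => oV _; rewrite mulmxA oV mul1mx.
  by apply: SO_mul => //; apply: SO_tr.
have i2 := bm_integrable (bm_mulmxl sV (conj mf (ex_intro _ B fB))).
have {i2} i2 : mu.-integrable setT (EFin \o (gS \o (fun U : 'M[R]_n => V *m U) : M -> R)).
  move: i2; rewrite (integrable_mkcond _ mS) restrict_EFin.
  by apply: eq_integrable => // U _ /=; rewrite -E.
under eq_integral do rewrite E.
rewrite -[LHS](integral_pushforward mV mfT (D := setT)) //.
by apply: eq_measure_integral => A mA _; apply: HHaar.2.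
Qed.

End Mean.

#[global] Opaque mean.

(** * Taylor bounds for sine, cosine and the exponential *)

Section ScalarTaylor.
Context {R : realType}.
Implicit Types (x y t h : R).

Lemma MVT0 (f df : R -> R) t : (forall x, is_derive x 1 f (df x)) ->
  exists2 c, `|c| <= `|t| & f t - f 0 = df c * t.
Proof.
move=> fdf.
have fc (i : interval R) x : x \in i -> derivable f x 1 by case: (fdf x).
have [t0|/ltW t0] := leP 0 t.
  have [c] := MVT_segment t0 (fun x _ => fdf x) (derivable_within_continuous (fc _)).
  rewrite in_itv /= subr0 => /andP[c0 ct] e; exists c => //.
  by rewrite !ger0_norm // (le_trans c0).
have [c] := MVT_segment t0 (fun x _ => fdf x) (derivable_within_continuous (fc _)).
rewrite in_itv /= sub0r => /andP[c0 ct] e; exists c.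
  by rewrite !ler0_norm // ?lerN2 // (le_trans ct).
by rewrite -[LHS]opprB e mulrN opprK.
Qed.

Lemma sin_norm_le t : `|sin t| <= `|t|.
Proof.
have [c _] := MVT0 t (@is_derive_sin R); rewrite sin0 subr0 => ->.
by rewrite normrM ler_piMl // cos_max.
Qed.

Lemma one_sub_cos_norm_le t : `|1 - cos t| <= t ^+ 2.
Proof.
have [c ct] := MVT0 t (@is_derive_cos R); rewrite cos0 -[X in `|X|]opprB normrN => ->.
rewrite normrM normrN -real_normK ?num_real // expr2 ler_wpM2r //.
exact: le_trans (sin_norm_le _) ct.
Qed.

Lemma one_sub_cos_norm_le1 t : `|1 - cos t| <= `|t|.
Proof.
have [c ct] := MVT0 t (@is_derive_cos R); rewrite cos0 -[X in `|X|]opprB normrN => ->.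
by rewrite normrM normrN ler_piMl // sin_max.
Qed.

Lemma sin_sub_norm_le t : `|sin t - t| <= t ^+ 2.
Proof.
have d x : is_derive x 1 (fun x : R => sin x - x) (cos x - 1).
  exact: is_deriveB.
have [c ct] := MVT0 t d; rewrite sin0 !subr0 => ->.
rewrite normrM -real_normK ?num_real // expr2 ler_wpM2r //.
rewrite distrC; exact: le_trans (one_sub_cos_norm_le1 _) ct.
Qed.

Lemma expR_taylor1 h : `|expR h - 1 - h| <= h ^+ 2 * expR `|h|.
Proof.
have e1 := expR_ge1Dx h; have e2 := expR_ge1Dx (- h).
have e0 := expR_gt0 h; have ee := expRxMexpNx_1 h.
have a1 : 1 <= expR `|h| by rewrite -expR0 ler_expR.
rewrite ger0_norm; last by lra.
have k : expR h - 1 <= h * expR h by nra.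
have [h0|h0] := leP 0 h.
  by rewrite (ger0_norm h0); nra.
have : h ^+ 2 <= h ^+ 2 * expR `|h| by rewrite ler_peMr // sqr_ge0.
by nra.
Qed.

Lemma expR_taylor2 x : `|expR x - 1 - x - x ^+ 2 / 2| <= `|x| ^+ 3 * expR `|x|.
Proof.
have d y : is_derive y 1 (fun y : R => expR y - 1 - y - y ^+ 2 / 2) (expR y - 1 - y).
  by apply: is_derive_eq; rewrite !scaler0 /GRing.scale /= mulr1; lra.
have [c cx] := MVT0 x d; rewrite expR0 subrr expr0n /= mul0r !subr0 => ->.
rewrite normrM; apply: le_trans (ler_wpM2r (normr_ge0 _) (expR_taylor1 _)) _.
have -> : `|x| ^+ 3 * expR `|x| = `|x| ^+ 2 * expR `|x| * `|x| by ring.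
rewrite -(real_normK (num_real c)) ler_wpM2r //.
by rewrite ler_pM ?sqr_ge0 ?expR_ge0 ?ler_expR // lerXn2r ?nnegrE.
Qed.

Lemma expR_lipschitz (B x y : R) : x <= B -> y <= B ->
  `|expR x - expR y| <= expR B * `|x - y|.
Proof.
wlog : x y / y <= x.
  move=> W xB yB; case/orP: (le_total y x) => xy; first exact: W.
  by rewrite distrC (distrC x) W.
move=> yx xB yB; rewrite ger0_norm ?subr_ge0 ?ler_expR //.
rewrite ger0_norm ?subr_ge0 //.
have := expR_ge1Dx (y - x); rewrite expRB ler_pdivlMr ?expR_gt0 // => e.
have : expR x * (x - y) <= expR B * (x - y) by rewrite ler_wpM2r ?subr_ge0 // ler_expR.
lra.
Qed.

End ScalarTaylor.

(** * Uniform Taylor bounds for the kernel exp (b <U, V>) *)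

Section KernelTaylor.
Context {R : realType} {n : nat}.
Implicit Types (S X U V W : 'M[R]_n) (t : R).

(** W is the position at time t of a curve leaving 1 with velocity S. Accuracy O(t^2) is all that is
    asked, so plane rotations and Cayley curves are treated alike. *)
Definition tangent (K : R) W S t :=
  nrm (W - 1%:M - t *: S) <= K * t ^+ 2.

Lemma nrm_Xgen_le (p : 'I_n * 'I_n) : nrm (@Xgen R n p) <= 2.
Proof.
rewrite /Xgen; apply: le_trans (nrmB _ _) _.
by rewrite /nrm !ip_deltal !mxE !eqxx sqrtr1; lra.
Qed.

(** 6 = 2 + 4: |X| <= 2 serves the sine term and |X^2| <= 4 the cosine term. *)
Lemma tangent_givens (p : 'I_n * 'I_n) t : tangent 6 (givens p t) (Xgen p) t.
Proof.
rewrite /tangent /givens.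
have -> : 1%:M + sin t *: Xgen p + (1 - cos t) *: (Xgen p *m Xgen p) - 1%:M
   - t *: Xgen p = (sin t - t) *: Xgen p + (1 - cos t) *: (Xgen p *m Xgen p).
  by rewrite scalerBl; move: (_ *m _) => Y; apply/matrixP => i j; rewrite !mxE; ring.
apply: le_trans (nrmD _ _) _; rewrite !nrmZ.
have x2 := nrm_Xgen_le p; have x0 := nrm_ge0 (@Xgen R n p).
have y2 := nrmM (@Xgen R n p) (Xgen p); have y0 := nrm_ge0 (@Xgen R n p *m Xgen p).
have s := sin_sub_norm_le t; have c := one_sub_cos_norm_le t.
have s0 := normr_ge0 (sin t - t); have c0 := normr_ge0 (1 - cos t).
have : `|sin t - t| * nrm (@Xgen R n p) <= t ^+ 2 * 2 by exact: ler_pM.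
have : `|1 - cos t| * nrm (@Xgen R n p *m Xgen p) <= t ^+ 2 * 4.
  by apply: ler_pM => //; apply: le_trans y2 _; nra.
lra.
Qed.

Variable b : R.

Definition ker U V : R := expR (b * ip U V).

Lemma ip_SO2_le U V : SO U -> SO V -> `|ip U V| <= n%:R * n%:R.
Proof.
move=> sU sV; apply: le_trans (ip_le_nrm _ _) _.
by apply: ler_pM; rewrite ?nrm_ge0 ?nrm_SO_le.
Qed.

Let E0 : R := expR (`|b| * (n%:R * n%:R)).
Let E0_ge0 : 0 <= E0. Proof. exact: expR_ge0. Qed.

Lemma ker_le U V : SO U -> SO V -> ker U V <= expR (`|b| * (n%:R * n%:R)).
Proof.
move=> sU sV; rewrite ler_expR; apply: le_trans (ler_norm _) _.
by rewrite normrM ler_wpM2l // ip_SO2_le.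
Qed.

Lemma ker_norm_le U V : SO U -> SO V -> `|ker U V| <= expR (`|b| * (n%:R * n%:R)).
Proof. by move=> sU sV; rewrite ger0_norm ?expR_ge0 // ker_le. Qed.

Lemma ker_lipschitz U V W : SO U -> SO V -> SO W ->
  `|ker U V - ker W V| <= expR (`|b| * (n%:R * n%:R)) * (`|b| * n%:R) * nrm (U - W).
Proof.
move=> sU sV sW; apply: le_trans (expR_lipschitz _ _) _.
- by move: (ker_le sU sV); rewrite ler_expR; apply.
- by move: (ker_le sW sV); rewrite ler_expR; apply.
rewrite -mulrA ler_wpM2l ?expR_ge0 // -mulrBr -ipBl normrM -mulrA ler_wpM2l //.
apply: le_trans (ip_le_nrm _ _) _; rewrite mulrC ler_wpM2r ?nrm_ge0 //.
exact: nrm_SO_le.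
Qed.

Lemma tangent_chord (K : R) W S t : 0 <= K -> `|t| <= 1 -> tangent K W S t ->
  nrm (W - 1%:M) <= (K + nrm S) * `|t|.
Proof.
move=> K0 t1 T; rewrite -(subrK (t *: S) (W - 1%:M)).
apply: le_trans (nrmD _ _) _; rewrite nrmZ mulrDl (mulrC `|t|) lerD2r.
apply: le_trans T _; rewrite ler_wpM2l //.
by rewrite -real_normK ?num_real // expr2 ler_piMl.
Qed.

(** Passing from U to W U multiplies the kernel by exp h with h = b <(W - 1) U, V> = O(t). The error
    is that of exp at h plus that of replacing W - 1 by t S. [K] precedes all matrices and t, thanks
    to |U| <= n on SO(n). *)
Lemma ker_taylor (K1 K2 : R) : 0 <= K1 -> 0 <= K2 ->
  exists2 K : R, 0 <= K & forall U V W S t, SO U -> SO V -> SO W ->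
  `|t| <= 1 -> nrm S <= K2 -> tangent K1 W S t ->
  `|ker (W *m U) V - ker U V - t * (b * ip (S *m U) V * ker U V)| <= K * t ^+ 2.
Proof.
move=> K10 K20.
pose H : R := `|b| * ((K1 + K2) * n%:R).
have H0 : 0 <= H by rewrite mulr_ge0 // mulr_ge0 // addr_ge0.
exists (E0 * (H ^+ 2 * expR H + `|b| * (K1 * n%:R))).
  by rewrite mulr_ge0 // addr_ge0 // !mulr_ge0 ?sqr_ge0 ?expR_ge0 ?addr_ge0.
move=> U V W S t sU sV sW t1 S2 T.
pose h := b * ip ((W - 1%:M) *m U) V.
pose a := b * ip (S *m U) V.
have hH : `|h| <= H * `|t|.
  rewrite normrM /H -mulrA ler_wpM2l // mulrAC.
  apply: le_trans (ip_SO_le _ sU sV) _; rewrite ler_wpM2r //.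
  apply: le_trans (tangent_chord K10 t1 T) _.
  by rewrite ler_wpM2r // lerD2l.
have hH1 : `|h| <= H by apply: le_trans hH _; rewrite ler_piMr.
have ha : `|h - t * a| <= `|b| * (K1 * n%:R) * t ^+ 2.
  rewrite /h /a mulrCA -mulrBr -ipZl -ipBl scalemxAl -mulmxBl normrM -mulrA ler_wpM2l //.
  by apply: le_trans (ip_SO_le _ sU sV) _; rewrite mulrAC ler_wpM2r.
have -> : ker (W *m U) V = ker U V * expR h.
  rewrite /ker -expRD; congr expR; rewrite /h mulmxBl mul1mx ipBl; ring.
have -> : ker U V * expR h - ker U V - t * (b * ip (S *m U) V * ker U V)
  = ker U V * ((expR h - 1 - h) + (h - t * a)) by rewrite /a; ring.
rewrite normrM -mulrA; apply: ler_pM => //; first exact: ker_norm_le.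
rewrite mulrDl; apply: le_trans (ler_normD _ _) (lerD _ ha).
apply: le_trans (expR_taylor1 _) _; rewrite [leRHS]mulrAC.
have hH2 : h ^+ 2 <= H ^+ 2 * t ^+ 2.
  rewrite -(real_normK (num_real h)) -(real_normK (num_real t)) -exprMn.
  by rewrite lerXn2r ?nnegrE // mulr_ge0.
by apply: ler_pM; rewrite ?sqr_ge0 ?expR_ge0 ?ler_expR.
Qed.

Lemma dker_taylor (K1 K2 : R) : 0 <= K1 -> 0 <= K2 ->
  exists2 K : R, 0 <= K & forall U V W X S t, SO U -> SO V -> SO W ->
  `|t| <= 1 -> nrm X <= K2 -> nrm S <= K2 -> tangent K1 W X t ->
  `|b * ip (W *m S *m U) V * ker (W *m U) V - b * ip (S *m U) V * ker U V
    - t * ((b * ip (X *m S *m U) V + b ^+ 2 * ip (X *m U) V * ip (S *m U) V) * ker U V)|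
  <= K * t ^+ 2.
Proof.
move=> K10 K20; have [K K0 HK] := ker_taylor K10 K20.
pose N : R := n%:R.
exists (`|b| * (K1 * K2 * N) * E0
  + (`|b| * (K2 * N) + `|b| * (K2 * K2 * N)) * K
  + (`|b| * (K2 * K2 * N)) * (`|b| * (K2 * N) * E0)).
  by rewrite !addr_ge0 // !mulr_ge0 // ?expR_ge0 // addr_ge0 // !mulr_ge0.
move=> U V W X S t sU sV sW t1 X2 S2 T.
have {}HK := HK _ _ _ _ _ sU sV sW t1 X2 T.
set e := ker U V in HK *; set eW := ker (W *m U) V in HK *.
set a := b * ip (S *m U) V; set a1 := b * ip (X *m S *m U) V.
set aW := b * ip (W *m S *m U) V; set x := b * ip (X *m U) V in HK *.
have e_le : `|e| <= E0 by apply: ker_norm_le.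
have eW_le : `|eW| <= E0 by apply: ker_norm_le => //; apply: SO_mul.
have x_le : `|x| <= `|b| * (K2 * N).
  rewrite normrM ler_wpM2l //; apply: le_trans (ip_SO_le _ sU sV) _.
  by rewrite ler_wpM2r.
have a_le : `|a| <= `|b| * (K2 * N).
  rewrite normrM ler_wpM2l //; apply: le_trans (ip_SO_le _ sU sV) _.
  by rewrite ler_wpM2r.
have a1_le : `|a1| <= `|b| * (K2 * K2 * N).
  rewrite normrM ler_wpM2l //; apply: le_trans (ip_SO_le _ sU sV) _.
  rewrite ler_wpM2r //; apply: le_trans (nrmM _ _) _.
  by apply: ler_pM; rewrite ?nrm_ge0.
have aW_le : `|aW - a - t * a1| <= `|b| * (K1 * K2 * N) * t ^+ 2.
  rewrite /aW /a /a1 (mulrCA t) -!mulrBr -ipZl -!ipBl -mulmxBl !scalemxAl -mulmxBl.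
  rewrite normrM -mulrA ler_wpM2l //; apply: le_trans (ip_SO_le _ sU sV) _.
  rewrite mulrAC ler_wpM2r // -{2}(mul1mx S) -!mulmxBl.
  apply: le_trans (nrmM _ _) _; rewrite mulrAC.
  by apply: ler_pM; rewrite ?nrm_ge0.
(* Product rule with remainder: the first-order error of each factor, times an approximation of the
   other, plus t^2 times the product of the two derivatives. *)
have -> : aW * eW - a * e - t * ((a1 + b ^+ 2 * ip (X *m U) V * ip (S *m U) V) * e)
  = (aW - a - t * a1) * eW + (a + t * a1) * (eW - e - t * (x * e))
    + t ^+ 2 * (a1 * (x * e)) by rewrite /x /a; ring.
have ta1 : `|a + t * a1| <= `|b| * (K2 * N) + `|b| * (K2 * K2 * N).
  apply: le_trans (ler_normD _ _) (lerD a_le _); rewrite normrM.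
  by apply: le_trans a1_le; rewrite ler_piMl.
have t20 : 0 <= t ^+ 2 by apply: sqr_ge0.
rewrite 2!(mulrDl _ _ (t ^+ 2)); apply: le_trans (ler_normD _ _) (lerD _ _).
  apply: le_trans (ler_normD _ _) (lerD _ _).
    by rewrite normrM mulrAC ler_pM.
  by rewrite normrM -[leRHS]mulrA ler_pM.
rewrite normrM (ger0_norm t20) mulrC ler_wpM2r // normrM ler_pM //.
by rewrite normrM ler_pM.
Qed.

End KernelTaylor.

(** Antisymmetrising does not increase the Hilbert-Schmidt norm, by (u - v)^2 <= 2 u^2 + 2 v^2. *)
Lemma sum_sub_swap_sqr_le {R : realFieldType} (I : finType) (h : I -> I -> R) :
  \sum_p \sum_q (h p q - h q p) ^+ 2 <= 4 * \sum_p \sum_q h p q ^+ 2.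
Proof.
apply: (@le_trans _ _ (\sum_p \sum_q (2 * h p q ^+ 2 + 2 * h q p ^+ 2))).
  apply: ler_sum => p _; apply: ler_sum => q _.
  by rewrite -subr_ge0 (_ : _ - _ = (h p q + h q p) ^+ 2) ?sqr_ge0 //; ring.
under eq_bigr do rewrite big_split /= -!mulr_sumr.
rewrite big_split /= -!mulr_sumr [X in _ + _ * X]exchange_big /= -mulrDl.
rewrite ler_wpM2r ?sumr_ge0 //; last by lra.
by move=> p _; apply: sumr_ge0 => q _; apply: sqr_ge0.
Qed.

(** * The mollified function and its first and second derivatives *)

Section Potential.
Context {R : realType} {n : nat}.
Local Notation M := (MBorel R n).
Variables (mu : probability M R) (HHaar : is_Haar_SO mu) (b : R).
Implicit Types (S X U V W : 'M[R]_n) (c : 'M[R]_n -> R) (t : R).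
Local Notation mean := (mean mu).

Definition pot c U := mean (fun V => c V * ker b U V).

(** The derivative of [pot c] along the vector field U |-> S U. *)
Definition dpot c S U := mean (fun V => c V * (b * ip (S *m U) V * ker b U V)).

(** The mixed derivative of [pot c] at exp (t X) exp (s S) U for t = s = 0. The order matters:
    exchanging X and S changes it by the derivative along their bracket. *)
Definition hpot c X S U := mean (fun V => c V *
  ((b * ip (X *m S *m U) V + b ^+ 2 * ip (X *m U) V * ip (S *m U) V) * ker b U V)).

Definition gradsq c U := \sum_p (dpot c (Xgen p) U) ^+ 2.

Lemma bm_ker U : bm (ker b U).
Proof. by apply: bm_exp; apply: bmZ; apply: bm_ip. Qed.

Lemma bm_dker S U : bm (fun V => b * ip (S *m U) V * ker b U V).
Proof. by apply: bmM; [apply: bmZ; apply: bm_ip|apply: bm_ker]. Qed.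

Lemma bm_hker X S U : bm (fun V =>
  (b * ip (X *m S *m U) V + b ^+ 2 * ip (X *m U) V * ip (S *m U) V) * ker b U V).
Proof.
apply: bmM; last exact: bm_ker.
apply: bmD; first by apply: bmZ; apply: bm_ip.
by apply: bmM; [apply: bmZ|]; apply: bm_ip.
Qed.

Lemma mean_mul_le (c g : 'M[R]_n -> R) (C B : R) : bm c -> bm g ->
  (forall U, SO U -> `|c U| <= C) -> (forall U, SO U -> `|g U| <= B) ->
  `|mean (fun U => c U * g U)| <= C * B.
Proof.
move=> bc bg cC gB; apply: (mean_norm_le HHaar); first exact: bmM.
by move=> U sU; rewrite normrM ler_pM ?cC ?gB.
Qed.

Lemma mean_mul_taylor c (f g h : 'M[R]_n -> R) t : bm c -> bm f -> bm g -> bm h ->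
  mean (fun V => c V * f V) - mean (fun V => c V * g V) - t * mean (fun V => c V * h V)
  = mean (fun V => c V * (f V - g V - t * h V)).
Proof.
move=> bc bf bg bh.
have bcf := bmM bc bf; have bcg := bmM bc bg; have bch := bmM bc bh.
rewrite -(meanZ HHaar) // -(meanB HHaar) // -(meanB HHaar) //.
- by apply: eq_mean => V _; ring.
- exact: bmB.
- exact: bmZ.
Qed.

Lemma pot_mulmxl c W U : SO W -> bm c ->
  pot (fun V => c (W *m V)) U = pot c (W *m U).
Proof.
move=> sW bc; rewrite /pot -[RHS](mean_mulmxl HHaar sW); last first.
  by apply: bmM => //; apply: bm_ker.
apply: eq_mean => V _; rewrite /ker; congr (_ * expR (_ * _)).
by rewrite ip_mull mulmxA; case: sW => -> _; rewrite mul1mx.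
Qed.

Lemma dpot_mulmxlE c W S U : SO W -> bm c ->
  dpot (fun V => c (W *m V)) S U =
  mean (fun V => c V * (b * ip (W *m S *m U) V * ker b (W *m U) V)).
Proof.
move=> sW bc; rewrite /dpot -[RHS](mean_mulmxl HHaar sW); last first.
  apply: bmM => //; apply: bmM; [apply: bmZ; apply: bm_ip|apply: bm_ker].
apply: eq_mean => V _; rewrite /ker -(mulmxA W).
have E A : ip (W *m A) (W *m V) = ip A V.
  by rewrite ip_mull mulmxA; case: sW => -> _; rewrite mul1mx.
by rewrite !E.
Qed.

(** The direction is conjugated because W S U = (W S W^T) (W U). *)
Lemma dpot_mulmxl c W S U : SO W -> bm c ->
  dpot (fun V => c (W *m V)) S U = dpot c (W *m S *m W^T) (W *m U).
Proof.
move=> sW bc; rewrite dpot_mulmxlE // /dpot; apply: eq_mean => V _.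
by rewrite -(mulmxA (W *m S)) (mulmxA W^T); case: sW => -> _; rewrite mul1mx.
Qed.

Lemma pot_lipschitz c (C : R) U W : bm c -> (forall V, SO V -> `|c V| <= C) ->
  SO U -> SO W ->
  `|pot c U - pot c W| <=
    C * (expR (`|b| * (n%:R * n%:R)) * (`|b| * n%:R) * nrm (U - W)).
Proof.
move=> bc cC sU sW.
have -> : pot c U - pot c W = mean (fun V => c V * (ker b U V - ker b W V)).
  rewrite /pot -(meanB HHaar); [|by apply: bmM => //; apply: bm_ker..].
  by apply: eq_mean => V _; rewrite mulrBr.
apply: mean_mul_le => //; first by apply: bmB; apply: bm_ker.
by move=> V sV; apply: ker_lipschitz.
Qed.

Lemma bm_pot c : bm c -> bm (pot c).
Proof.
move=> bc; have [_ [C cC]] := bc; apply: lipschitz_SO_bm.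
exists (C * (expR (`|b| * (n%:R * n%:R)) * (`|b| * n%:R))) => U W sU sW.
by rewrite -mulrA; apply: pot_lipschitz.
Qed.

Lemma pot_taylor (C K1 K2 : R) : 0 <= C -> 0 <= K1 -> 0 <= K2 ->
  exists2 K : R, 0 <= K & forall c U W S t, bm c ->
  (forall V, SO V -> `|c V| <= C) -> SO U -> SO W ->
  `|t| <= 1 -> nrm S <= K2 -> tangent K1 W S t ->
  `|pot c (W *m U) - pot c U - t * dpot c S U| <= K * t ^+ 2.
Proof.
move=> C0 K10 K20; have [K K0 HK] := @ker_taylor R n b K1 K2 K10 K20.
exists (C * K); first exact: mulr_ge0.
move=> c U W S t bc cC sU sW t1 S2 T.
have bS := bm_dker S U; have bU := bm_ker U; have bW := bm_ker (W *m U).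
rewrite /pot /dpot mean_mul_taylor // -mulrA; apply: mean_mul_le => //.
  by apply: bmB; [apply: bmB|apply: bmZ].
by move=> V sV; apply: HK.
Qed.

Lemma dpot_taylor (C K1 K2 : R) : 0 <= C -> 0 <= K1 -> 0 <= K2 ->
  exists2 K : R, 0 <= K & forall c U W X S t, bm c ->
  (forall V, SO V -> `|c V| <= C) -> SO U -> SO W ->
  `|t| <= 1 -> nrm X <= K2 -> nrm S <= K2 -> tangent K1 W X t ->
  `|dpot (fun V => c (W *m V)) S U - dpot c S U - t * hpot c X S U| <= K * t ^+ 2.
Proof.
move=> C0 K10 K20; have [K K0 HK] := @dker_taylor R n b K1 K2 K10 K20.
exists (C * K); first exact: mulr_ge0.
move=> c U W X S t bc cC sU sW t1 X2 S2 T.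
have b1 : bm (fun V => b * ip (W *m S *m U) V * ker b (W *m U) V).
  by apply: bmM; [apply: bmZ; apply: bm_ip|apply: bm_ker].
have b2 := bm_dker S U; have b3 := bm_hker X S U.
rewrite dpot_mulmxlE // /dpot /hpot mean_mul_taylor // -mulrA; apply: mean_mul_le => //.
  by apply: bmB; [apply: bmB|apply: bmZ].
by move=> V sV; apply: HK.
Qed.

Lemma b_ip_le (K2 : R) S U V : SO U -> SO V -> nrm S <= K2 ->
  `|b * ip (S *m U) V| <= `|b| * (K2 * n%:R).
Proof.
move=> sU sV S2; rewrite normrM ler_wpM2l //; apply: le_trans (ip_SO_le _ sU sV) _.
by rewrite ler_wpM2r.
Qed.

Lemma dpot_bound (C K2 : R) : 0 <= C -> 0 <= K2 ->
  exists2 K : R, 0 <= K & forall c U S, bm c -> (forall V, SO V -> `|c V| <= C) ->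
  SO U -> nrm S <= K2 -> `|dpot c S U| <= K.
Proof.
move=> C0 K20; exists (C * (`|b| * (K2 * n%:R) * expR (`|b| * (n%:R * n%:R)))).
  by rewrite !mulr_ge0 ?expR_ge0.
move=> c U S bc cC sU S2; apply: mean_mul_le => //; first exact: bm_dker.
by move=> V sV; rewrite normrM ler_pM ?ker_norm_le ?b_ip_le.
Qed.

Lemma hpot_bound (C K2 : R) : 0 <= C -> 0 <= K2 ->
  exists2 K : R, 0 <= K & forall c U X S, bm c -> (forall V, SO V -> `|c V| <= C) ->
  SO U -> nrm X <= K2 -> nrm S <= K2 -> `|hpot c X S U| <= K.
Proof.
move=> C0 K20; set B := `|b| * (K2 * n%:R).
exists (C * ((`|b| * (K2 * K2 * n%:R) + B * B) * expR (`|b| * (n%:R * n%:R)))).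
  by rewrite mulr_ge0 // mulr_ge0 ?expR_ge0 // addr_ge0 // !mulr_ge0.
move=> c U X S bc cC sU X2 S2; apply: mean_mul_le => //; first exact: bm_hker.
move=> V sV; rewrite normrM ler_pM ?ker_norm_le //.
apply: le_trans (ler_normD _ _) (lerD _ _).
  apply: b_ip_le => //; apply: le_trans (nrmM _ _) _.
  by apply: ler_pM; rewrite ?nrm_ge0.
rewrite (_ : b ^+ 2 * _ * _ = (b * ip (X *m U) V) * (b * ip (S *m U) V)); last by ring.
by rewrite normrM ler_pM ?b_ip_le.
Qed.

(** Represents the linear form S |-> [dpot c S U], so that sums over the frame fall under the matrix
    identities for [Xgen]. *)
Definition gradm c U : 'M[R]_n := \matrix_(i, j) dpot c (delta_mx i j) U.

Lemma dpotE c S U : bm c -> dpot c S U = ip S (gradm c U).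
Proof.
move=> bc; rewrite ipE /dpot.
have bb (i j : 'I_n) : bm (fun V => c V * (b * ip (delta_mx i j *m U) V * ker b U V)).
  by apply: bmM => //; apply: bm_dker.
transitivity (mean (fun V => \sum_i \sum_j
    S i j * (c V * (b * ip (delta_mx i j *m U) V * ker b U V)))).
  apply: eq_mean => V _; rewrite ip_mulr ipE.
  rewrite mulr_sumr mulr_suml mulr_sumr; apply: eq_bigr => i _.
  rewrite mulr_sumr mulr_suml mulr_sumr; apply: eq_bigr => j _.
  rewrite ip_mulr ip_deltal; ring.
rewrite (mean_sum HHaar); last by move=> i; apply: bm_sum => j; apply: bmZ.
apply: eq_bigr => i _; rewrite (mean_sum HHaar); last by move=> j; apply: bmZ.
by apply: eq_bigr => j _; rewrite (meanZ HHaar) // mxE.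
Qed.

Lemma gradsq_mulmxl c W U : SO W -> bm c ->
  gradsq (fun V => c (W *m V)) U = gradsq c (W *m U).
Proof.
move=> sW bc; rewrite /gradsq.
transitivity (\sum_p (ip (W *m Xgen p *m W^T) (gradm c (W *m U))) ^+ 2).
  by apply: eq_bigr => p _; rewrite dpot_mulmxl // dpotE.
rewrite sum_ip_conj_Xgen_sqr //.
by apply: eq_bigr => p _; rewrite dpotE.
Qed.

Lemma hpot_sub c X S U : bm c ->
  hpot c X S U - hpot c S X U = dpot c (X *m S - S *m X) U.
Proof.
move=> bc; have b1 Y Z := bmM bc (bm_hker Y Z U).
rewrite /hpot -(meanB HHaar) //; apply: eq_mean => V _.
rewrite mulmxBl ipBl; ring.
Qed.

Lemma hpotN c X S U : bm c -> hpot c (- X) S U = - hpot c X S U.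
Proof.
move=> bc; rewrite -[RHS]mulN1r -(meanZ HHaar); last exact: bmM bc (bm_hker X S U).
by apply: eq_mean => V _; rewrite !mulNmx !ipNl; ring.
Qed.

(** Exchanging the entries of p negates [Xgen p], so the walk has no drift; this removes the term
    linear in t from averaged derivatives. *)
Lemma sum_hpot c S U : bm c -> \sum_p hpot c (Xgen p) S U = 0.
Proof.
move=> bc; set s := LHS; have : s = - s.
  rewrite {1}/s (reindex_inj (h := fun p : 'I_n * 'I_n => (p.2, p.1))) /=; last first.
    by move=> [i j] [k l] [-> ->].
  by rewrite -sumrN; apply: eq_bigr => p _; rewrite Xgen_swap hpotN.
move: s => s; lra.
Qed.

(** The symmetric part of the second derivatives is discarded; the factor 4 lost in antisymmetrising
    cancels the 4 of the bracket identity. *)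
Lemma gradsq_le_hpot c U : bm c ->
  (n%:R - 2) * gradsq c U <= \sum_p \sum_q (hpot c (Xgen p) (Xgen q) U) ^+ 2.
Proof.
move=> bc.
have := sum_sub_swap_sqr_le (fun p q => hpot c (Xgen p) (Xgen q) U).
have -> : \sum_p \sum_q (hpot c (Xgen p) (Xgen q) U - hpot c (Xgen q) (Xgen p) U) ^+ 2
  = 4 * (n%:R - 2) * gradsq c U.
  have -> : gradsq c U = \sum_p (ip (Xgen p) (gradm c U)) ^+ 2.
    by apply: eq_bigr => p _; rewrite dpotE.
  rewrite -sum_ip_bracket_sqr; apply: eq_bigr => p _; apply: eq_bigr => q _.
  by rewrite hpot_sub // dpotE.
move: (\sum_p _) (gradsq _ _) => y z; lra.
Qed.

End Potential.

(** * Finite averages: exponential moments and the gap in Jensen's inequality *)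

Section Average.
Context {R : realType} {I : finType}.
Implicit Types (f g : I -> R) (a : R).

Definition avg f : R := (\sum_i f i) / #|I|%:R.

Lemma avgD f g : avg (fun i => f i + g i) = avg f + avg g.
Proof. by rewrite /avg big_split mulrDl. Qed.

Lemma avgZ a f : avg (fun i => a * f i) = a * avg f.
Proof. by rewrite /avg -mulr_sumr mulrA. Qed.

Lemma eq_avg f g : (forall i, f i = g i) -> avg f = avg g.
Proof. by move=> fg; rewrite /avg (eq_bigr _ (fun i _ => fg i)). Qed.

Lemma le_avg f g : (forall i, f i <= g i) -> avg f <= avg g.
Proof. by move=> fg; rewrite ler_wpM2r ?invr_ge0 ?ler0n // ler_sum. Qed.

Lemma sum_avg (J : finType) (f : J -> I -> R) :
  \sum_j avg (f j) = avg (fun i => \sum_j f j i).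
Proof. by rewrite /avg -mulr_suml exchange_big. Qed.

Hypothesis I0 : (0 < #|I|)%N.

Lemma avg_cst a : avg (fun=> a) = a.
Proof.
by rewrite /avg sumr_const -[a *+ _]mulr_natr mulfK // pnatr_eq0 -lt0n.
Qed.

Lemma avg_norm_le f a : (forall i, `|f i| <= a) -> `|avg f| <= a.
Proof.
move=> fa; rewrite ler_norml; apply/andP; split.
  by rewrite -(avg_cst (- a)); apply: le_avg => i; have := fa i; rewrite ler_norml => /andP[].
by rewrite -(avg_cst a); apply: le_avg => i; have := fa i; rewrite ler_norml => /andP[].
Qed.

Lemma avg_sub_sqr f a : avg (fun i => (f i - a) ^+ 2)
  = avg (fun i => f i ^+ 2) - 2 * a * avg f + a ^+ 2.
Proof.
rewrite -[X in _ + X](avg_cst (a ^+ 2)) -mulNr -avgZ -!avgD.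
by congr avg; apply/funext => i; ring.
Qed.

(** Factoring out exp (lam avg f) exactly leaves centred exponents x of size O(t): the linear term
    averages to 0, the quadratic one gives lam^2 / 2 times the variance of f, and the cubic
    remainder is O(t^3). *)
Lemma avg_exp_le (f d : I -> R) (F t lam B K L : R) : L = 2 * lam * (B + K) ->
  0 <= t <= 1 -> 0 <= lam ->
  0 <= B -> 0 <= K -> (forall i, `|d i| <= B) ->
  (forall i, `|f i - F - t * d i| <= K * t ^+ 2) ->
  avg (fun i => expR (lam * f i)) <= expR (lam ^+ 2 * t ^+ 2 / 2 * avg (fun i => d i ^+ 2)
   + (lam ^+ 2 / 2 * (2 * B * K + K ^+ 2) + L ^+ 3 * expR L) * t ^+ 3)
   * expR (lam * avg f).
Proof.
move=> LE /andP[t0 t1] lam0 B0 K0 dB fd.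
have L0 : 0 <= L by rewrite LE !mulr_ge0 // addr_ge0.
have t2 : t ^+ 2 <= t by rewrite expr2 ler_piMl.
have fF i : `|f i - F| <= (B + K) * t.
  have := fd i; have := dB i; rewrite !ler_norml; move: (f i - F) (d i) => x y.
  by move=> /andP[? ?] /andP[? ?]; apply/andP; split; nra.
have aF : `|avg f - F| <= (B + K) * t.
  have -> : avg f - F = avg (fun i => f i - F) by rewrite avgD avg_cst.
  exact: avg_norm_le.
pose x i := lam * (f i - avg f).
have xL i : `|x i| <= L * t.
  rewrite normrM ger0_norm // LE.
  have -> : 2 * lam * (B + K) * t = lam * (2 * ((B + K) * t)) by ring.
  rewrite ler_wpM2l //.
  have := fF i; move: aF; rewrite !ler_norml; move: (f i) (avg f) => u v.
  by move=> /andP[? ?] /andP[? ?]; apply/andP; split; lra.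
have xL1 i : `|x i| <= L by apply: le_trans (xL i) _; rewrite ler_piMr.
have ex i : expR (x i) <= 1 + x i + x i ^+ 2 / 2 + L ^+ 3 * expR L * t ^+ 3.
  have := expR_taylor2 (x i).
  have : `|x i| ^+ 3 * expR `|x i| <= L ^+ 3 * expR L * t ^+ 3.
    rewrite [leRHS]mulrAC -exprMn ler_pM ?exprn_ge0 ?expR_ge0 ?ler_expR //.
    by rewrite lerXn2r ?nnegrE // mulr_ge0.
  have := ler_norm (expR (x i) - 1 - x i - x i ^+ 2 / 2).
  lra.
have x0 : avg x = 0 by rewrite /x avgZ avgD avg_cst subrr mulr0.
have x2 : avg (fun i => x i ^+ 2) <=
    lam ^+ 2 * (t ^+ 2 * avg (fun i => d i ^+ 2) + (2 * B * K + K ^+ 2) * t ^+ 3).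
  have -> : avg (fun i => x i ^+ 2) = lam ^+ 2 * avg (fun i => (f i - avg f) ^+ 2).
    by rewrite -avgZ; congr avg; apply/funext => i; rewrite exprMn.
  rewrite ler_wpM2l ?sqr_ge0 //.
  (* The mean minimises the average squared deviation, so it may be replaced by the base value [F]
     of the expansion. *)
  apply: (@le_trans _ _ (avg (fun i => (f i - F) ^+ 2))).
    rewrite !avg_sub_sqr; have := sqr_ge0 (avg f - F).
    move: (avg f) (avg _) => u v; lra.
  rewrite -(avg_cst ((2 * B * K + K ^+ 2) * t ^+ 3)) -avgZ -avgD; apply: le_avg => i.
  have := fd i; have := dB i.
  set r := f i - F - t * d i; have -> : f i - F = t * d i + r by rewrite /r; ring.
  move: r (d i) => r y yB rK.
  have : `|y| * `|r| <= B * (K * t ^+ 2) by rewrite ler_pM.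
  have : `|r| ^+ 2 <= (K * t ^+ 2) ^+ 2 by rewrite lerXn2r ?nnegrE // mulr_ge0 ?sqr_ge0.
  rewrite real_normK ?num_real // -normrM => r2 yr.
  have t4 : t ^+ 4 <= t ^+ 3 by rewrite exprS ler_piMl // exprn_ge0.
  have : t * (y * r) <= t * (B * (K * t ^+ 2)).
    by rewrite ler_wpM2l // (le_trans (ler_norm _)).
  have : K ^+ 2 * t ^+ 4 <= K ^+ 2 * t ^+ 3 by rewrite ler_wpM2l ?sqr_ge0.
  lra.
have -> : avg (fun i => expR (lam * f i)) = avg (fun i => expR (x i)) * expR (lam * avg f).
  rewrite [RHS]mulrC -[RHS]avgZ; congr avg; apply/funext => i.
  by rewrite -expRD; congr expR; rewrite /x; ring.
rewrite ler_wpM2r ?expR_ge0 //.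
apply: le_trans (le_avg ex) _.
rewrite !avgD !avg_cst x0 addr0.
have -> : avg (fun i => x i ^+ 2 / 2) = 2^-1 * avg (fun i => x i ^+ 2).
  by rewrite -avgZ; congr avg; apply/funext => i; rewrite mulrC.
apply: le_trans (expR_ge1Dx _).
move: x2; move: (avg _) (avg _) => u v; lra.
Qed.

(** The gap in Jensen's inequality is the variance of y. Since h averages to 0, avg y is within K
    t^2 of D, so y - avg y is t h up to 2 K t^2, and the cross term costs 4 B K t^3. *)
Lemma sqr_avg_le (y h : I -> R) (D t B K : R) : 0 <= t <= 1 ->
  0 <= B -> 0 <= K -> (forall i, `|h i| <= B) -> avg h = 0 ->
  (forall i, `|y i - D - t * h i| <= K * t ^+ 2) ->
  avg y ^+ 2 <= avg (fun i => y i ^+ 2) - t ^+ 2 * avg (fun i => h i ^+ 2)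
     + 4 * B * K * t ^+ 3.
Proof.
move=> /andP[t0 t1] B0 K0 hB h0 yK.
have YD : `|avg y - D| <= K * t ^+ 2.
  have -> : avg y - D = avg (fun i => y i - D - t * h i).
    have -> : (fun i => y i - D - t * h i) = (fun i => y i + (- D + (- t) * h i)).
      by apply/funext => i; ring.
    by rewrite !avgD avg_cst avgZ h0 mulr0 addr0.
  exact: avg_norm_le.
have : avg (fun i => (y i - avg y) ^+ 2) = avg (fun i => y i ^+ 2) - avg y ^+ 2.
  by rewrite avg_sub_sqr; ring.
have : t ^+ 2 * avg (fun i => h i ^+ 2) - 4 * B * K * t ^+ 3
    <= avg (fun i => (y i - avg y) ^+ 2).
  rewrite -avgZ -[X in - X](avg_cst (4 * B * K * t ^+ 3)) -mulN1r -avgZ -avgD.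
  apply: le_avg => i; have := yK i; have := hB i; rewrite mulN1r.
  set r := y i - D - t * h i => hiB rK.
  pose s := r - (avg y - D).
  have -> : y i - avg y = t * h i + s by rewrite /s /r; ring.
  have sK : `|s| <= 2 * K * t ^+ 2.
    by apply: le_trans (ler_normB _ _) _; move: rK YD; lra.
  have : `|h i| * `|s| <= B * (2 * K * t ^+ 2) by rewrite ler_pM.
  rewrite -normrM => hs.
  have : - (h i * s) <= B * (2 * K * t ^+ 2).
    by rewrite (le_trans (ler_norm _)) // normrN.
  move: (h i) s {sK hs} => u v uv.
  have : t * - (u * v) <= t * (B * (2 * K * t ^+ 2)) by rewrite ler_wpM2l.
  have := sqr_ge0 v; lra.
move: (avg _) (avg _) (avg _) (avg _) => p q r s; lra.
Qed.

(** A cruder comparison with the value D at the unrotated point; an error of order t is affordable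
    because the result gets multiplied by t^2. *)
Lemma sqr_avg_le_center (y h : I -> R) (D t B K : R) : 0 <= t <= 1 ->
  0 <= B -> 0 <= K -> `|D| <= B -> avg h = 0 ->
  (forall i, `|y i - D - t * h i| <= K * t ^+ 2) ->
  avg y ^+ 2 <= D ^+ 2 + (2 * B * K + K ^+ 2) * t.
Proof.
move=> /andP[t0 t1] B0 K0 DB h0 yK.
have YD : `|avg y - D| <= K * t ^+ 2.
  have -> : avg y - D = avg (fun i => y i - D - t * h i).
    have -> : (fun i => y i - D - t * h i) = (fun i => y i + (- D + (- t) * h i)).
      by apply/funext => i; ring.
    by rewrite !avgD avg_cst avgZ h0 mulr0 addr0.
  exact: avg_norm_le.
have t2 : t ^+ 2 <= t by rewrite expr2 ler_piMl.
have {}YD : `|avg y - D| <= K * t by apply: le_trans YD _; rewrite ler_wpM2l.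
move: (avg y) YD => Y; set r := Y - D; have -> : Y = D + r by rewrite /r; ring.
move: r => r rK.
have : `|D| * `|r| <= B * (K * t) by rewrite ler_pM.
have : `|r| ^+ 2 <= (K * t) ^+ 2 by rewrite lerXn2r ?nnegrE // mulr_ge0.
rewrite real_normK ?num_real // -normrM => r2 /(le_trans (ler_norm _)) Dr.
have : K ^+ 2 * t ^+ 2 <= K ^+ 2 * t by rewrite ler_wpM2l ?sqr_ge0.
lra.
Qed.

End Average.

(** * One step of the walk: exponential moment and gradient *)

Section OneStep.
Context {R : realType} {n : nat}.
Local Notation M := (MBorel R n).
Variables (mu : probability M R) (HHaar : is_Haar_SO mu) (b : R).
Hypothesis n0 : (0 < n)%N.
Implicit Types (S X U V W : 'M[R]_n) (c : 'M[R]_n -> R) (t : R).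
Local Notation mean := (mean mu).
Local Notation pot := (pot mu b).
Local Notation dpot := (dpot mu b).
Local Notation hpot := (hpot mu b).
Local Notation gradsq := (gradsq mu b).

Definition step t c V := avg (fun p : 'I_n * 'I_n => c (givens p t *m V)).

Lemma pair_card_gt0 : (0 < #|{: 'I_n * 'I_n}|)%N.
Proof. by rewrite card_prod card_ord muln_gt0 n0. Qed.

Lemma bm_avg (I : finType) (F : I -> 'M[R]_n -> R) :
  (forall i, bm (F i)) -> bm (fun U => avg (fun i => F i U)).
Proof. by move=> bF; apply: bmM; [apply: bm_sum|apply: bm_cst]. Qed.

Lemma mean_avg (I : finType) (F : I -> 'M[R]_n -> R) :
  (forall i, bm (F i)) -> mean (fun U => avg (fun i => F i U)) = avg (fun i => mean (F i)).
Proof.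
move=> bF; rewrite /avg -(mean_sum HHaar) // mulrC -(meanZ HHaar); last exact: bm_sum.
by apply: eq_mean => U _; rewrite mulrC.
Qed.

Lemma bm_step t c : bm c -> bm (step t c).
Proof. by move=> bc; apply: bm_avg => p; apply: bm_mulmxl => //; apply: SO_givens. Qed.

Lemma step_norm_le t c (C : R) : (forall V, SO V -> `|c V| <= C) ->
  forall V, SO V -> `|step t c V| <= C.
Proof.
move=> cC V sV; apply: avg_norm_le; first exact: pair_card_gt0.
by move=> p; apply: cC; apply: SO_mul => //; apply: SO_givens.
Qed.

Lemma mean_mul_avg (I : finType) (F : I -> 'M[R]_n -> R) g : (forall i, bm (F i)) -> bm g ->
  mean (fun V => avg (fun i => F i V) * g V) = avg (fun i => mean (fun V => F i V * g V)).
Proof.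
move=> bF bg; rewrite -mean_avg; last by move=> i; apply: bmM.
by apply: eq_mean => V _; rewrite mulrC -avgZ; congr avg; apply/funext => i; rewrite mulrC.
Qed.

Lemma pot_step t c U : bm c -> pot (step t c) U = avg (fun p => pot c (givens p t *m U)).
Proof.
move=> bc; rewrite /pot mean_mul_avg; last exact: bm_ker.
  apply: eq_avg => p; exact: (pot_mulmxl HHaar b U (SO_givens p t) bc).
by move=> p; apply: bm_mulmxl => //; apply: SO_givens.
Qed.

Lemma dpot_step t c S U : bm c ->
  dpot (step t c) S U = avg (fun p => dpot (fun V => c (givens p t *m V)) S U).
Proof.
move=> bc; rewrite /dpot mean_mul_avg //; last exact: bm_dker.
by move=> p; apply: bm_mulmxl => //; apply: SO_givens.
Qed.

Lemma mean_pot_step t c : bm c -> mean (pot (step t c)) = mean (pot c).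
Proof.
move=> bc; have bp := bm_pot HHaar b bc.
rewrite -[RHS](avg_cst pair_card_gt0).
transitivity (mean (fun U => avg (fun p => pot c (givens p t *m U)))).
  by apply: eq_mean => U _; apply: pot_step.
rewrite mean_avg; last by move=> p; apply: bm_mulmxl => //; apply: SO_givens.
apply: eq_avg => p; exact: (mean_mulmxl HHaar (SO_givens p t) bp).
Qed.

(** By left invariance, the mean of exp (lam [pot c]) is that of its average over the n^2 rotations
    of the step; the bound for averaged exponentials then applies at each U, with base value
    [pot c U]. *)
Lemma mgf_step (C lam : R) : 0 <= C -> 0 <= lam ->
  exists2 K : R, 0 <= K & forall c q t, bm c -> (forall V, SO V -> `|c V| <= C) ->
  0 <= t <= 1 -> (forall U, SO U -> gradsq c U <= q) ->
  mean (fun U => expR (lam * pot c U)) <=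
   expR (lam ^+ 2 * t ^+ 2 / 2 * (q / n%:R ^+ 2) + K * t ^+ 3) *
   mean (fun U => expR (lam * pot (step t c) U)).
Proof.
move=> C0 lam0.
have [K K0 HK] := pot_taylor HHaar b C0 (ler0n R 6) (ler0n R 2).
have [B B0 HB] := dpot_bound HHaar b C0 (ler0n R 2).
pose L := 2 * lam * (B + K).
have L0 : 0 <= L by rewrite !mulr_ge0 // addr_ge0.
exists (lam ^+ 2 / 2 * (2 * B * K + K ^+ 2) + L ^+ 3 * expR L).
  by rewrite addr_ge0 ?mulr_ge0 ?addr_ge0 ?mulr_ge0 ?exprn_ge0 ?expR_ge0.
move=> c q t bc cC t01 gq; have /andP[t0 t1] := t01.
have bp := bm_pot HHaar b bc.
have be : bm (fun U => expR (lam * pot c U)) by apply: bm_exp; apply: bmZ.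
have bs := bm_pot HHaar b (bm_step t bc).
have bes : bm (fun U => expR (lam * pot (step t c) U)) by apply: bm_exp; apply: bmZ.
have beg p : bm (fun U => expR (lam * pot c (givens p t *m U))).
  by apply: (bm_mulmxl (f := fun U => expR (lam * pot c U))) => //; apply: SO_givens.
rewrite -(meanZ HHaar) //.
rewrite -[leLHS](avg_cst pair_card_gt0).
have -> : (fun _ : 'I_n * 'I_n => mean (fun U => expR (lam * pot c U)))
  = fun p => mean (fun U => expR (lam * pot c (givens p t *m U))).
  apply/funext => p; exact: (esym (mean_mulmxl HHaar (SO_givens p t) be)).
rewrite -mean_avg //; apply: (le_mean HHaar); [exact: bm_avg|exact: bmZ|].
move=> U sU; rewrite pot_step //.
apply: le_trans (avg_exp_le pair_card_gt0 (erefl L) t01 lam0 B0 K0 (F := pot c U)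
  (d := fun p => dpot c (Xgen p) U) _ _) _.
- by move=> p; apply: HB => //; apply: nrm_Xgen_le.
- move=> p; apply: HK => //; [exact: SO_givens|by rewrite ger0_norm|exact: nrm_Xgen_le|].
  exact: tangent_givens.
rewrite ler_wpM2r ?expR_ge0 // ler_expR lerD2r ler_wpM2l //.
  by rewrite !mulr_ge0 ?sqr_ge0.
rewrite /avg card_prod card_ord natrM -expr2 ler_wpM2r ?invr_ge0 ?sqr_ge0 //.
exact: gq.
Qed.

(** The gain at U is kap t^2 times [gradsq c U], which may lie far below the supremum q. It is
    therefore expressed through the new value, which exceeds the old one by at most O(t); this puts
    the factor 1 + kap t^2 on the left. *)
Lemma gradsq_step (C : R) : 0 <= C -> (2 <= n)%N ->
  exists2 K : R, 0 <= K & forall c q t, bm c -> (forall V, SO V -> `|c V| <= C) ->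
  0 <= t <= 1 -> (forall U, SO U -> gradsq c U <= q) ->
  forall U, SO U ->
  gradsq (step t c) U * (1 + (n%:R - 2) / n%:R ^+ 2 * t ^+ 2) <= q + K * t ^+ 3.
Proof.
move=> C0 n2.
have [K K0 HK] := dpot_taylor HHaar b C0 (ler0n R 6) (ler0n R 2).
have [B1 B10 HB1] := dpot_bound HHaar b C0 (ler0n R 2).
have [B2 B20 HB2] := hpot_bound HHaar b C0 (ler0n R 2).
pose B := B1 + B2; have B0 : 0 <= B by apply: addr_ge0.
pose N : R := #|{: 'I_n * 'I_n}|%:R.
have NE : N = n%:R ^+ 2 by rewrite /N card_prod card_ord natrM expr2.
have N0 : 0 < N by rewrite ltr0n pair_card_gt0.
pose kap := (n%:R - 2) / N.
have kap0 : 0 <= kap by rewrite divr_ge0 ?(ltW N0) // subr_ge0 (ler_nat R 2).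
pose K1 := N * (4 * B * K); pose K2 := N * (2 * B * K + K ^+ 2).
have K10 : 0 <= K1 by rewrite !mulr_ge0 // ltW.
have K20 : 0 <= K2 by rewrite mulr_ge0 ?(ltW N0) // addr_ge0 ?sqr_ge0 ?mulr_ge0.
exists (K1 + kap * K2); first by rewrite addr_ge0 // mulr_ge0.
move=> c q t bc cC t01 gq U sU; have /andP[t0 t1] := t01.
rewrite -NE -/kap.
pose y s p := dpot (fun V => c (givens p t *m V)) (Xgen s) U.
pose h s p := hpot c (Xgen p) (Xgen s) U.
have hB s p : `|h s p| <= B.
  apply: (@le_trans _ _ B2); last by rewrite /B lerDr.
  by apply: HB2 => //; apply: nrm_Xgen_le.
have dB s : `|dpot c (Xgen s) U| <= B.
  apply: (@le_trans _ _ B1); last by rewrite /B lerDl.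
  by apply: HB1 => //; apply: nrm_Xgen_le.
have h0 s : avg (h s) = 0 by rewrite /avg /h (sum_hpot HHaar) // mul0r.
have yK s p : `|y s p - dpot c (Xgen s) U - t * h s p| <= K * t ^+ 2.
  apply: HK => //; [exact: SO_givens|by rewrite ger0_norm|exact: nrm_Xgen_le..|].
  exact: tangent_givens.
have E : gradsq (step t c) U = \sum_s avg (y s) ^+ 2.
  by apply: eq_bigr => s _; rewrite dpot_step.
have le1 : gradsq (step t c) U <= q - t ^+ 2 * (kap * gradsq c U) + K1 * t ^+ 3.
  rewrite E; apply: (@le_trans _ _ (\sum_s (avg (fun p => y s p ^+ 2)
     - t ^+ 2 * avg (fun p => h s p ^+ 2) + 4 * B * K * t ^+ 3))).
    apply: ler_sum => s _.
    exact: (sqr_avg_le pair_card_gt0 t01 B0 K0 (hB s) (h0 s) (yK s)).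
  rewrite !big_split /= sumr_const -[_ *+ _]mulr_natl (mulrA _ (4 * B * K)) -/N -/K1.
  (* Rotating the density rotates the point and conjugates the frame, so this is an average of
     [gradsq c] over rotated points, each term at most q. *)
  have -> : \sum_s avg (fun p => y s p ^+ 2) = avg (fun p => gradsq c (givens p t *m U)).
    rewrite sum_avg; apply: eq_avg => p.
    exact: (gradsq_mulmxl HHaar b U (SO_givens p t) bc).
  rewrite sumrN -mulr_sumr sum_avg lerD2r; apply: lerB.
    rewrite -[leRHS](avg_cst pair_card_gt0); apply: le_avg => p; apply: gq.
    by apply: SO_mul => //; apply: SO_givens.
  rewrite ler_wpM2l ?sqr_ge0 // /avg -/N /kap mulrAC.
  rewrite ler_wpM2r ?invr_ge0 ?(ltW N0) //.
  exact: (gradsq_le_hpot HHaar b U bc).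
have le2 : gradsq (step t c) U <= gradsq c U + K2 * t.
  rewrite E; apply: (@le_trans _ _ (\sum_s (dpot c (Xgen s) U ^+ 2
     + (2 * B * K + K ^+ 2) * t))).
    apply: ler_sum => s _.
    exact: (sqr_avg_le_center pair_card_gt0 t01 B0 K0 (dB s) (h0 s) (yK s)).
  by rewrite big_split /= sumr_const -[_ *+ _]mulr_natl mulrA.
move: (gradsq (step t c) U) (gradsq c U) le1 le2 => x z le1 le2.
have : t ^+ 2 * (kap * x) <= t ^+ 2 * (kap * (z + K2 * t)).
  by rewrite ler_wpM2l ?sqr_ge0 // ler_wpM2l.
move: le1; lra.
Qed.

End OneStep.

(** * Joining SO(n) to the identity by plane rotations *)

Section Connectivity.
Context {R : realType} {n : nat}.
Implicit Types (U V : 'M[R]_n) (t r : R).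

Lemma cos_sin_onto (c s : R) : c ^+ 2 + s ^+ 2 = 1 ->
  exists t, [/\ `|t| <= pi, cos t = c & sin t = s].
Proof.
move=> cs; have c1 : -1 <= c <= 1.
  by have := sqr_ge0 s; move: cs; rewrite -ler_norml; have := real_normK (num_real c);
  have := normr_ge0 c; move: `|c| => x; nra.
have ca : cos (acos c) = c by rewrite acosK // in_itv.
have sa : sin (acos c) = `|s|.
  by rewrite sin_acos // (_ : 1 - _ = s ^+ 2) ?sqrtr_sqr //; lra.
have a0 := acos_ge0 c1; have ap := acos_lepi c1.
have [s0|/ltW s0] := leP 0 s.
  by exists (acos c); rewrite ger0_norm // sa ger0_norm.
by exists (- acos c); rewrite normrN ger0_norm // cosN sinN sa ler0_norm ?opprK.
Qed.

Lemma mul_delta_mxE (i j a l : 'I_n) U : (delta_mx i j *m U) a l = (a == i)%:R * U j l.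
Proof.
rewrite mxE (bigD1 j) //= big1 ?addr0; first by rewrite mxE eqxx andbT.
by move=> k /negbTE kj; rewrite mxE kj andbF mul0r.
Qed.

Lemma mul_XgenE (p : 'I_n * 'I_n) U a l :
  (Xgen p *m U) a l = (a == p.1)%:R * U p.2 l - (a == p.2)%:R * U p.1 l.
Proof. by rewrite mulmxBl !mxE -!mul_delta_mxE !mxE. Qed.

Lemma givens_mulE (i j a l : 'I_n) t U : i != j ->
  (givens (i, j) t *m U) a l =
  if a == i then cos t * U i l + sin t * U j l
  else if a == j then cos t * U j l - sin t * U i l else U a l.
Proof.
move=> ij.
have -> : givens (i, j) t *m U = U + sin t *: (Xgen (i, j) *m U)
    + (1 - cos t) *: (Xgen (i, j) *m (Xgen (i, j) *m U)).
  rewrite /givens; move: (Xgen _) => X.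
  by rewrite !mulmxDl mul1mx -!scalemxAl -mulmxA.
rewrite mxE [X in X + _]mxE [X in _ + X + _]mxE [X in _ + X]mxE.
rewrite !mul_XgenE /= !eqxx (eq_sym j i) (negbTE ij).
have [->|_] := eqVneq a i; first by rewrite ?(negbTE ij) /=; ring.
by have [->|_] := eqVneq a j; rewrite /=; ring.
Qed.

Let cols (m : nat) U := forall k a : 'I_n, (k < m)%N -> U a k = (a == k)%:R.

Let zeros (m : 'I_n) (l : nat) U := forall i : 'I_n, (m < i < l)%N -> U i m = 0.

(** The rotation takes (a, b) to (r, 0), r being its length, so the pivot becomes nonnegative.
    Earlier columns vanish in rows m and i and are left alone. *)
Let givens_eliminate (m i : 'I_n) U : (m < i)%N -> cols m U -> zeros m i U ->
  exists t, [/\ `|t| <= pi, cols m (givens (m, i) t *m U),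
    zeros m i.+1 (givens (m, i) t *m U) & 0 <= (givens (m, i) t *m U) m m].
Proof.
move=> mi cU zU; have nmi : m != i by rewrite -val_eqE /= ltn_eqF.
set a := U m m; set b := U i m.
have [t [tpi tc ts]] : exists t, [/\ `|t| <= pi, cos t * b - sin t * a = 0
    & 0 <= cos t * a + sin t * b].
  have ab0 : 0 <= a ^+ 2 + b ^+ 2 by rewrite addr_ge0 ?sqr_ge0.
  pose r := Num.sqrt (a ^+ 2 + b ^+ 2).
  have r2 : r ^+ 2 = a ^+ 2 + b ^+ 2 by rewrite sqr_sqrtr.
  have [r0|nr] := eqVneq r 0.
    have a0 := sqr_ge0 a; have b0 := sqr_ge0 b.
    have /eqP : a ^+ 2 = 0 by move: r2; rewrite r0 expr0n /=; lra.
    have /eqP : b ^+ 2 = 0 by move: r2; rewrite r0 expr0n /=; lra.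
    rewrite !sqrf_eq0 => /eqP -> /eqP ->.
    by exists 0; rewrite normr0 pi_ge0 !mulr0 subrr addr0.
  have [t [tpi ct st]] := @cos_sin_onto (a / r) (b / r) ltac:(
    by rewrite !expr_div_n -mulrDl -r2 divff // expf_neq0).
  exists t; rewrite ct st; split => //; first by field.
  have -> : a / r * a + b / r * b = r ^+ 2 / r by rewrite r2; field.
  by rewrite expr2 mulfK // sqrtr_ge0.
exists t; split => //.
- move=> k x km; rewrite givens_mulE // !cU //.
  have -> : (m == k) = false by rewrite -val_eqE /= gtn_eqF.
  have -> : (i == k) = false by rewrite -val_eqE /= gtn_eqF // (ltn_trans km).
  rewrite !mulr0 addr0 subr0.
  have [->|_] := eqVneq x m; first by rewrite -val_eqE /= gtn_eqF.
  by have [->|//] := eqVneq x i; rewrite -val_eqE /= gtn_eqF // (ltn_trans km).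
- move=> x /andP[mx]; rewrite ltnS => xi; rewrite givens_mulE //.
  have -> : (x == m) = false by rewrite -val_eqE /= gtn_eqF.
  have [_ //|nxi] := eqVneq x i.
  by apply: zU; rewrite mx ltn_neqAle xi andbT val_eqE.
by rewrite givens_mulE // eqxx.
Qed.

Variables (f : 'M[R]_n -> R) (r : R).
Hypothesis r0 : 0 <= r.
Hypothesis f_givens : forall U p t, SO U -> `|t| <= pi -> `|f (givens p t *m U) - f U| <= r.

(** Induction on the number d of rows still to be cleared. The pivot is known to be nonnegative only
    after a rotation, whence the guards [m.+1 < l] and [m.+1 < n]. *)
Let eliminate_column (d : nat) (m : 'I_n) (l : nat) U :
  (l + d = n)%N -> (m < l)%N -> SO U -> cols m U -> zeros m l U ->
  ((m.+1 < l)%N -> 0 <= U m m) ->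
  exists V, [/\ SO V, cols m V, zeros m n V, ((m.+1 < n)%N -> 0 <= V m m)
    & `|f V - f U| <= d%:R * r].
Proof.
elim: d l U => [|d IH] l U.
  rewrite addn0 => ln _ sU cU zU pU; rewrite ln in zU pU; exists U; split => //.
  by rewrite subrr normr0 mul0r.
move=> ldn ml sU cU zU pU.
have ln : (l < n)%N by rewrite -ldn -[X in (X < _)%N]addn0 ltn_add2l.
have [t [tpi cV zV pV]] := @givens_eliminate m (Ordinal ln) U ml cU zU.
have sV := SO_mul (SO_givens (m, Ordinal ln) t) sU.
have e : (l.+1 + d = n)%N by rewrite addSnnS.
have [W [sW cW zW pW fW]] := IH l.+1 _ e (leqW ml) sV cV zV (fun=> pV).
exists W; split => //.
rewrite -(subrK (f (givens (m, Ordinal ln) t *m U)) (f W)) -addrA.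
rewrite -natr1 mulrDl mul1r; apply: le_trans (ler_normD _ _) (lerD fW _).
exact: f_givens.
Qed.

(** Column a is already e_a, so its orthogonality to column k produces the zeros above the diagonal
    without any rotation. *)
Let SO_col_le (m : nat) U (k a : 'I_n) : SO U -> cols m U -> (a < m)%N -> a != k -> U a k = 0.
Proof.
move=> [oU _] cU am ak; have := congr1 (fun A : 'M[R]_n => A a k) oU.
rewrite !mxE (negbTE ak) (bigD1 a) //= big1 ?addr0.
  by rewrite mxE cU // eqxx mul1r.
by move=> x /negbTE xa; rewrite mxE cU // xa mul0r.
Qed.

Let SO_col_sqr U (k : 'I_n) : SO U -> (forall a : 'I_n, a != k -> U a k = 0) -> U k k ^+ 2 = 1.
Proof.
move=> [oU _] U0; have := congr1 (fun A : 'M[R]_n => A k k) oU.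
rewrite !mxE eqxx (bigD1 k) //= big1 ?addr0.
  by rewrite mxE expr2.
by move=> x xk; rewrite mxE U0 // mul0r.
Qed.

Let eliminate_columns (m : nat) U : (m < n)%N -> SO U ->
  exists V, [/\ SO V, cols m V & `|f V - f U| <= m%:R * (n%:R * r)].
Proof.
elim: m => [|m IH] mn sU.
  by exists U; split => //; rewrite subrr normr0 mul0r.
have mn' := ltnW mn; have [V [sV cV fV]] := IH mn' sU.
pose k := Ordinal mn'.
have zV : zeros k m.+1 V by move=> i /andP[mi]; rewrite ltnS leqNgt mi.
have pV : (k.+1 < m.+1)%N -> 0 <= V k k by rewrite ltnn.
have [W [sW cW zW pW fW]] := @eliminate_column _ k _ _ (subnKC mn') (ltnSn m) sV cV zV pV.
have W0 a : a != k -> W a k = 0.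
  move=> ak; case: (ltngtP a m) => [am|ma|am].
  - exact: (SO_col_le sW cW am ak).
  - by apply: zW; rewrite ma ltn_ord.
  - by rewrite -val_eqE /= am eqxx in ak.
have W1 : W k k = 1.
  have := SO_col_sqr sW W0; have := pW mn; move: (W k k) => x x0 x2.
  by apply/eqP; rewrite -(@eqrXn2 _ 2) // ?expr1n ?x2.
exists W; split => //.
  move=> j a; rewrite ltnS leq_eqVlt => /orP[/eqP jm|jm]; last exact: cW.
  have -> : j = k by apply: val_inj.
  by have [->|ak] := eqVneq a k; [rewrite W1|rewrite W0].
rewrite -natr1 mulrDl mul1r (_ : f W - f U = (f V - f U) + (f W - f V)); last by ring.
apply: le_trans (ler_normD _ _) (lerD fV _).
by apply: le_trans fW _; rewrite ler_wpM2r // ler_nat leq_subr.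
Qed.

(** Clearing n - 1 columns, with at most n rotations each, already leads to the identity, and each
    rotation moves f by at most r. *)
Lemma givens_connect U : SO U -> `|f U - f 1%:M| <= n%:R * (n%:R * r).
Proof.
case: (posnP n) => [n0|n0] sU.
  have -> : U = 1%:M by apply/matrixP => i; by have := leq_ltn_trans (leq0n i) (ltn_ord i); rewrite [X in (_ < X)%N]n0.
  by rewrite subrr normr0 !mulr_ge0.
have n1 : (n.-1 < n)%N by rewrite prednK.
have [V [sV cV fV]] := eliminate_columns n1 sU.
pose k := Ordinal n1.
have V0 a : a != k -> V a k = 0.
  move=> ak; apply: (SO_col_le sV cV) => //.
  by rewrite ltn_neqAle -ltnS prednK // ltn_ord andbT; rewrite -val_eqE /= in ak.
have Vd : V = diag_mx (\row_j V j j).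
  apply/matrixP => a j; rewrite !mxE.
  have [jm|jm] := ltnP j n.-1.
    by rewrite (cV j a) //; case: (eqVneq a j) => [->|_]; rewrite ?mulr0n // mulr1n cV ?eqxx.
  have -> : j = k.
    by apply: val_inj => /=; apply/eqP; rewrite eqn_leq jm andbT -ltnS prednK.
  by have [->|ak] := eqVneq a k; [rewrite mulr1n|rewrite V0].
(* No rotation controls the sign of the last diagonal entry; the determinant fixes it. *)
have V1 : V k k = 1.
  have := sV.2; rewrite {1}Vd det_diag (bigD1 k) //= big1 ?mulr1; first by rewrite mxE.
  move=> j jk; rewrite mxE cV ?eqxx //.
  by rewrite ltn_neqAle -ltnS prednK // ltn_ord andbT; rewrite -val_eqE /= in jk.
have {}V1 : V = 1%:M.
  rewrite Vd; apply/matrixP => a j; rewrite !mxE.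
  have [jm|jm] := ltnP j n.-1; first by case: (eqVneq a j) => [->|_]; rewrite ?mulr0n // mulr1n cV ?eqxx.
  have -> : j = k.
    by apply: val_inj => /=; apply/eqP; rewrite eqn_leq jm andbT -ltnS prednK.
  by case: (eqVneq a k) => [->|_]; rewrite ?mulr0n // mulr1n V1.
rewrite -V1 distrC; apply: le_trans fV _.
by rewrite ler_wpM2r ?mulr_ge0 // ler_nat leq_pred.
Qed.

End Connectivity.

(** * Limits along 1/m and increments along a line *)

Section Oscillation.
Context {R : realType}.

Lemma exists_nat_gt (x : R) : exists m : nat, (0 < m)%N /\ x <= m%:R.
Proof.
have x0 : 0 <= Num.max x 0 by rewrite le_max lexx orbT.
exists (Num.bound (Num.max x 0)).+1; split=> //.
apply: (@le_trans _ _ (Num.max x 0)); first by rewrite le_max lexx.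
by rewrite ltW // (lt_trans (archi_boundP x0)) // ltr_nat.
Qed.

Lemma le_of_inv_nat (x y a : R) : (forall m : nat, (0 < m)%N -> x <= y + a / m%:R) -> x <= y.
Proof.
move=> H; apply/ler_addgt0Pr => e e0.
have [m [m0 am]] := exists_nat_gt (a / e).
apply: le_trans (H m m0) _; rewrite lerD2l ler_pdivrMr ?ltr0n //.
by move: am; rewrite ler_pdivrMr // mulrC.
Qed.

Lemma bernoulli (y : R) (k : nat) : 0 <= y -> 1 + k%:R * y <= (1 + y) ^+ k.
Proof.
move=> y0; elim: k => [|k IH]; first by rewrite mul0r addr0 expr0.
rewrite exprS -natr1; have : 0 <= k%:R * y by rewrite mulr_ge0.
move: (_ ^+ k) (k%:R) IH => z w IH wy; nra.
Qed.

(** With m m0 equal steps the quadratic errors add up to at most K th^2 / m, which vanishes in the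
    limit; the factor m0 >= |th| keeps each step within length 1. *)
Lemma lipschitz_subdivide (f : R -> R) (r K th : R) : 0 <= K ->
  (forall x s, `|s| <= 1 -> `|f (x + s) - f x| <= `|s| * r + K * s ^+ 2) ->
  `|f th - f 0| <= `|th| * r.
Proof.
move=> K0 fK.
have S (s : R) (m : nat) : `|s| <= 1 ->
    `|f (m%:R * s) - f 0| <= m%:R * (`|s| * r + K * s ^+ 2).
  move=> s1; elim: m => [|m IH]; first by rewrite mul0r subrr normr0 mul0r.
  rewrite -natr1 !mulrDl !mul1r.
  have -> : f (m%:R * s + s) - f 0 = (f (m%:R * s) - f 0) + (f (m%:R * s + s) - f (m%:R * s)).
    by ring.
  exact: le_trans (ler_normD _ _) (lerD IH (fK _ _ s1)).
have [m0 [m00 thm]] := exists_nat_gt `|th|.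
apply: (@le_of_inv_nat _ _ (K * th ^+ 2)) => m m1.
have mm0 : (0 < m * m0)%N by rewrite muln_gt0 m1.
have p : 0 < (m * m0)%:R :> R by rewrite ltr0n.
have p1 : 0 < m%:R :> R by rewrite ltr0n.
have p2 : 1 <= m0%:R :> R by rewrite (ler_nat R 1).
pose s := th / (m * m0)%:R.
have s1 : `|s| <= 1.
  rewrite normrM normfV (ger0_norm (ltW p)) ler_pdivrMr // mul1r.
  by rewrite (le_trans thm) // ler_nat leq_pmull.
have := S s (m * m0)%N s1; rewrite {1}/s mulrC mulfVK ?gt_eqF // => H.
apply: le_trans H _; rewrite mulrDr mulrA; apply: lerD.
  by rewrite normrM normfV (ger0_norm (ltW p)) mulrCA mulfV ?gt_eqF // mulr1.
have -> : (m * m0)%:R * (K * s ^+ 2) = K * th ^+ 2 / (m * m0)%:R.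
  by rewrite /s; move: (m * m0)%:R p => N p; field; rewrite gt_eqF.
apply: ler_wpM2l; first by rewrite mulr_ge0 ?sqr_ge0.
by rewrite lef_pV2 ?posrE // ler_nat leq_pmulr.
Qed.

End Oscillation.

(** * Iterating the walk, and the exponential moment of the mollified function *)

Section Iteration.
Context {R : realType} {n : nat}.
Local Notation M := (MBorel R n).
Variables (mu : probability M R) (HHaar : is_Haar_SO mu) (b : R).
Hypothesis n3 : (2 < n)%N.
Implicit Types (U V W : 'M[R]_n) (c : 'M[R]_n -> R) (t q : R).
Local Notation mean := (mean mu).
Local Notation pot := (pot mu b).
Local Notation gradsq := (gradsq mu b).

Let n0 : (0 < n)%N. Proof. exact: ltn_trans n3. Qed.

Lemma gradsq_ge0 c U : 0 <= gradsq c U.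
Proof. by apply: sumr_ge0 => p _; apply: sqr_ge0. Qed.

Lemma dpot_le_gradsq c q p U : gradsq c U <= q -> `|dpot mu b c (Xgen p) U| <= Num.sqrt q.
Proof.
move=> gq; rewrite -sqrtr_sqr ler_sqrt ?(le_trans (gradsq_ge0 c U) gq) //.
apply: le_trans gq; rewrite [leRHS](bigD1 p) //= lerDl.
by apply: sumr_ge0 => i _; apply: sqr_ge0.
Qed.

(** A plane rotation moves [pot c] by at most its angle times sqrt q. At most n^2 rotations of angle
    at most pi join a point to 1, and comparing two points through 1 doubles the bound. *)
Lemma pot_osc c q U : bm c -> (forall V, SO V -> gradsq c V <= q) -> SO U ->
  `|pot c U - mean (pot c)| <= 2 * (n%:R * (n%:R * (pi * Num.sqrt q))).
Proof.
move=> bc gq sU; have [_ [C cC]] := bc.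
have C0 : 0 <= C by apply: le_trans (cC _ (SO_one n)).
have [K K0 HK] := pot_taylor HHaar b C0 (ler0n R 6) (ler0n R 2).
have G V p t : SO V -> `|t| <= pi ->
    `|pot c (givens p t *m V) - pot c V| <= pi * Num.sqrt q.
  move=> sV tpi; apply: (@le_trans _ _ (`|t| * Num.sqrt q)); last by rewrite ler_wpM2r ?sqrtr_ge0.
  have -> : pot c V = pot c (givens p 0 *m V) by rewrite givens0 mul1mx.
  apply: (lipschitz_subdivide (f := fun t => pot c (givens p t *m V)) t K0) => x s s1.
  have sxV := SO_mul (SO_givens p x) sV.
  rewrite (addrC x) givensD -mulmxA.
  have := HK c _ _ (Xgen p) s bc cC sxV (SO_givens p s) s1 (nrm_Xgen_le p) (tangent_givens p s).
  have := dpot_le_gradsq p (gq _ sxV).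
  move: (pot _ _) (pot _ _) (dpot _ _ _ _ _) (Num.sqrt q) => u v d w dw.
  have : `|s * d| <= `|s| * w by rewrite normrM ler_wpM2l.
  rewrite !ler_norml; move: (`|s|) (s * d) (K * _) => x1 x2 x3.
  by move=> /andP[? ?] /andP[? ?]; apply/andP; split; lra.
have r0 : 0 <= pi * Num.sqrt q by rewrite mulr_ge0 ?pi_ge0 ?sqrtr_ge0.
have H V : SO V -> `|pot c V - pot c 1%:M| <= n%:R * (n%:R * (pi * Num.sqrt q)).
  by move=> sV; apply: (givens_connect r0 G).
have bp := bm_pot HHaar b bc.
have : `|mean (fun V => pot c V - pot c U)| <= 2 * (n%:R * (n%:R * (pi * Num.sqrt q))).
  apply: (mean_norm_le HHaar); first exact: (bmB bp (bm_cst (pot c U))).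
  move=> V sV; have := H V sV; have := H U sU.
  move: (pot c V) (pot c U) (pot c _) (n%:R * _) => x y z w.
  by rewrite !ler_norml => /andP[? ?] /andP[? ?]; apply/andP; split; lra.
have -> : mean (fun V => pot c V - pot c U) = mean (pot c) - pot c U.
  transitivity (mean (pot c) - mean (fun=> pot c U)).
    exact: (meanB HHaar bp (bm_cst (pot c U))).
  by congr (_ - _); exact: (mean_cst HHaar).
by rewrite distrC.
Qed.

Let kap : R := (n%:R - 2) / n%:R ^+ 2.

Let n2_gt0 : 0 < n%:R - 2 :> R.
Proof. by rewrite subr_gt0 (ltr_nat R 2). Qed.

Let kap_gt0 : 0 < kap.
Proof. by rewrite divr_gt0 // exprn_gt0 // ltr0n. Qed.

(* The potential lam^2 (1 + kap t^2) q / (2 (n - 2)) decreases by exactly the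
   variance term of one step, since kap = (n - 2) / n^2. *)
Let potential_identity (lam t q q' K a : R) : a = 1 + kap * t ^+ 2 -> 0 < a ->
  lam ^+ 2 * a / (2 * (n%:R - 2)) * ((q + K * t ^+ 3) / a - q')
  = lam ^+ 2 * a / (2 * (n%:R - 2)) * (q - q')
   - lam ^+ 2 * t ^+ 2 / 2 * (q / n%:R ^+ 2)
   + lam ^+ 2 * K / (2 * (n%:R - 2)) * t ^+ 3.
Proof.
have N0 : n%:R != 0 :> R by rewrite pnatr_eq0 -lt0n.
have nu0 := n2_gt0; rewrite /kap.
move: (n%:R - 2) nu0 => nu nu0 aE a0.
have -> : lam ^+ 2 * a / (2 * nu) * ((q + K * t ^+ 3) / a - q')
   = lam ^+ 2 / (2 * nu) * (q + K * t ^+ 3) - lam ^+ 2 * a / (2 * nu) * q'.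
  by field; rewrite !gt_eqF.
by rewrite aE; field; rewrite N0 gt_eqF.
Qed.

(** The variance costs telescope, each being paid by the decrease of q up to O(t^3). Averaging keeps
    |c| <= C, so the constants of a single step are fixed once, before k. *)
Lemma iterate_step (C lam : R) : 0 <= C -> 0 <= lam ->
  exists2 K : R, 0 <= K & forall (k : nat) c q t, bm c -> (forall V, SO V -> `|c V| <= C) ->
  0 <= t <= 1 -> 0 <= q -> (forall U, SO U -> gradsq c U <= q) ->
  exists c' q', [/\ bm c' /\ mean (pot c') = mean (pot c),
    0 <= q', forall U, SO U -> gradsq c' U <= q',
    q' <= q / (1 + kap * t ^+ 2) ^+ k + k%:R * K * t ^+ 3 &
    mean (fun U => expR (lam * pot c U)) <=
    expR (lam ^+ 2 * (1 + kap * t ^+ 2) / (2 * (n%:R - 2)) * (q - q') + k%:R * K * t ^+ 3)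
     * mean (fun U => expR (lam * pot c' U))].
Proof.
move=> C0 lam0.
have [K1 K10 H1] := mgf_step HHaar b n0 C0 lam0.
have [K2 K20 H2] := gradsq_step HHaar b n0 C0 (ltnW n3).
pose K3 := lam ^+ 2 * K2 / (2 * (n%:R - 2)).
have K30 : 0 <= K3 by rewrite divr_ge0 ?mulr_ge0 ?sqr_ge0 // ltW.
exists (K1 + K2 + K3); first by rewrite !addr_ge0.
have ar1 (x y m T : R) : 0 <= T -> y <= K2 * T ->
    x + y + m * (K1 + K2 + K3) * T <= x + (m + 1) * (K1 + K2 + K3) * T.
  by move=> T0; have := mulr_ge0 (addr_ge0 K10 K30) T0; lra.
have ar2 (x v m T : R) : 0 <= T ->
    v + K1 * T + (x - v + K3 * T + m * (K1 + K2 + K3) * T)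
    <= x + (m + 1) * (K1 + K2 + K3) * T.
  by move=> T0; have := mulr_ge0 K20 T0; lra.
elim=> [|k IH] c q t bc cC t01 q0 gq.
  exists c, q; split; [by []|exact: q0|exact: gq|by rewrite expr0 divr1 !mul0r addr0|].
  by rewrite subrr mulr0 !mul0r addr0 expR0 mul1r.
have /andP[t0 t1] := t01.
set a := 1 + kap * t ^+ 2 in IH *.
have a1 : 1 <= a by rewrite lerDl mulr_ge0 ?sqr_ge0 // ltW.
have a0 : 0 < a by apply: lt_le_trans a1.
have t3 : 0 <= t ^+ 3 by apply: exprn_ge0.
pose q1 := (q + K2 * t ^+ 3) / a.
have q10 : 0 <= q1 by rewrite divr_ge0 ?addr_ge0 ?mulr_ge0 // ltW.
have gq1 U : SO U -> gradsq (step t c) U <= q1.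
  by move=> sU; rewrite ler_pdivlMr //; apply: H2.
have [c' [q' [[bc' mc'] q'0 gq' q'le mgf]]] :=
  IH (step t c) q1 t (bm_step t bc) (step_norm_le n0 t cC) t01 q10 gq1.
exists c', q'; split; [split; [exact: bc'|]|exact: q'0|exact: gq'| |].
- by rewrite mc'; exact: (mean_pot_step HHaar b n0 t bc).
- apply: le_trans q'le _.
  have -> : q1 / a ^+ k = q / a ^+ k.+1 + K2 * t ^+ 3 / a ^+ k.+1.
    by rewrite /q1 -mulrA -invfM -exprS mulrDl.
  rewrite -natr1; apply: ar1 => //.
  have ak : 1 <= a ^+ k.+1 by apply: exprn_ege1.
  by apply: ler_piMr; [exact: mulr_ge0|rewrite invf_le1 // exprn_gt0].
apply: le_trans (H1 c q t bc cC t01 gq) _.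
apply: le_trans (ler_wpM2l (expR_ge0 _) mgf) _.
rewrite mulrA -expRD; set m1 := mean _.
have m10 : 0 <= m1.
  have bp' : bm (fun U => expR (lam * pot c' U)).
    exact: bm_exp (bmZ _ (bm_pot HHaar b bc')).
  rewrite -(mean_cst HHaar 0).
  by apply: (le_mean HHaar (bm_cst 0) bp') => U _; apply: expR_ge0.
rewrite ler_wpM2r // ler_expR.
rewrite (potential_identity lam q q' K2 (erefl a) a0) -/K3.
rewrite -[k.+1%:R]natr1; exact: ar2.
Qed.

Lemma mgf_bound (lam q : R) c : 0 <= lam -> bm c ->
  (forall U, SO U -> gradsq c U <= q) ->
  mean (fun U => expR (lam * pot c U)) <=
  expR (lam * mean (pot c) + lam ^+ 2 * q / (2 * (n%:R - 2))).
Proof.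
move=> lam0 bc gq; have [_ [C cC]] := bc.
have C0 : 0 <= C by apply: le_trans (cC _ (SO_one n)).
have q0 : 0 <= q by apply: le_trans (gq _ (SO_one n)); apply: gradsq_ge0.
have [K K0 HK] := iterate_step C0 lam0.
pose beta := lam ^+ 2 * q / (2 * (n%:R - 2)).
have beta0 : 0 <= beta by rewrite divr_ge0 ?mulr_ge0 ?sqr_ge0 // ltW.
pose Q := q / kap + K.
have Q0 : 0 <= Q by rewrite addr_ge0 // divr_ge0 // ltW.
pose D := 2 * (n%:R * (n%:R * (pi * Num.sqrt Q))).
have D0 : 0 <= D by rewrite !mulr_ge0 ?pi_ge0 ?sqrtr_ge0.
(* A walk is run for each j with total error O(1/j); the limit is taken on logarithms. *)
suff H (j : nat) : (0 < j)%N -> mean (fun U => expR (lam * pot c U)) <=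
    expR (lam * mean (pot c) + beta + (beta * kap + K + lam * D) / j%:R).
  move: H; rewrite -/beta; move: (mean _) (lam * _ + beta) (_ + _ + _) => x y a H.
  have [x0|x0] := leP x 0; first exact: le_trans x0 (expR_ge0 _).
  rewrite -(lnK x0) ler_expR; apply: (@le_of_inv_nat _ _ _ a) => j j0.
  by rewrite -ler_expR lnK //; apply: H.
move=> j0; have jR : 0 < j%:R :> R by rewrite ltr0n.
pose x : R := j%:R^-1.
have x0 : 0 < x by rewrite invr_gt0.
have x1 : x <= 1 by rewrite invf_le1 // (ler_nat R 1).
(* Here k t^2 = j^2, so by Bernoulli's inequality q' is O(j^-2) and the remaining oscillation is
   O(1/j), while the accumulated error k K t^3 = K j^-2 vanishes as well. *)
pose k := (j ^ 10)%N; pose t := x ^+ 4.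
have t0 : 0 <= t by rewrite exprn_ge0 // ltW.
have t01 : 0 <= t <= 1 by rewrite t0 exprn_ile1 // ltW.
have kE : k%:R = x ^- 10 by rewrite /k natrX /x exprVn invrK.
have kt3 : k%:R * K * t ^+ 3 = K * x ^+ 2.
  by rewrite kE /t; field; rewrite gt_eqF.
have kt2 : k%:R * (kap * t ^+ 2) = kap * x ^- 2.
  by rewrite kE /t; move: kap => l; field; rewrite gt_eqF.
have t2x : t ^+ 2 <= x.
  by rewrite /t -exprM exprS ler_piMr ?exprn_ile1 // ltW.
have x2x : x ^+ 2 <= x by rewrite expr2 ler_piMr // ltW.
have e1 q' : 0 <= q' ->
    lam ^+ 2 * (1 + kap * t ^+ 2) / (2 * (n%:R - 2)) * (q - q') <= beta + beta * kap * x.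
  move=> q'0; apply: (@le_trans _ _ (beta + beta * kap * t ^+ 2)).
    have -> : beta + beta * kap * t ^+ 2 = lam ^+ 2 * (1 + kap * t ^+ 2) / (2 * (n%:R - 2)) * q.
      by rewrite /beta; ring.
    apply: ler_wpM2l; last by rewrite gerBl.
    apply: divr_ge0; last by rewrite mulr_ge0 // ltW.
    by rewrite mulr_ge0 ?sqr_ge0 // addr_ge0 // mulr_ge0 ?sqr_ge0 // ltW.
  by rewrite lerD2l ler_wpM2l // mulr_ge0 // ltW.
have e2 : K * x ^+ 2 <= K * x by rewrite ler_wpM2l.
have := HK k c q t bc cC t01 q0 gq; rewrite kt3.
move=> [c' [q' [[bc' mc'] q'0 gq' q'le mgf]]].
have q'x : Num.sqrt q' <= Num.sqrt Q * x.
  rewrite -[X in _ * X](ger0_norm (ltW x0)) -sqrtr_sqr -sqrtrM // ler_sqrt; last first.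
    by rewrite mulr_ge0 ?sqr_ge0.
  apply: le_trans q'le _; rewrite /Q mulrDl lerD2r.
  have kx : 0 < kap * x ^- 2 by rewrite mulr_gt0 // invr_gt0 exprn_gt0.
  have B : kap * x ^- 2 <= (1 + kap * t ^+ 2) ^+ k.
    rewrite -kt2; apply: le_trans (bernoulli _ _); first by rewrite lerDr.
    by rewrite mulr_ge0 ?sqr_ge0 // ltW.
  have -> : q / kap * x ^+ 2 = q / (kap * x ^- 2).
    by move: kap kap_gt0 => l l0; field; rewrite !gt_eqF.
  by rewrite ler_wpM2l // lef_pV2 ?posrE // (lt_le_trans kx).
apply: le_trans mgf _.
have bp' := bm_pot HHaar b bc'.
have le' : mean (fun U => expR (lam * pot c' U)) <= expR (lam * (mean (pot c) + D * x)).
  rewrite -[leRHS](mean_cst HHaar).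
  apply: (le_mean HHaar (bm_exp (bmZ lam bp')) (bm_cst _)) => U sU.
  rewrite ler_expR ler_wpM2l // -lerBlDl -mc'.
  apply: le_trans (ler_norm _) _; apply: le_trans (pot_osc bc' gq' sU) _.
  rewrite /D -!mulrA; do 2 rewrite ler_wpM2l //.
  by rewrite !ler_wpM2l ?pi_ge0.
apply: le_trans (ler_wpM2l (expR_ge0 _) le') _.
rewrite -expRD ler_expR.
rewrite -/x; move: (e1 q' q'0) e2.
move: (mean _) (_ * (q - q')) => u v; lra.
Qed.

End Iteration.

(** * Mollifying a Lipschitz function on SO(n) *)

Section Mollification.
Context {R : realType} {n : nat}.
Local Notation M := (MBorel R n).
Variables (mu : probability M R) (HHaar : is_Haar_SO mu).
Implicit Types (U V W : 'M[R]_n) (c F : 'M[R]_n -> R) (t : R).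
Local Notation mean := (mean mu).

(* At U the gradient in so(n) is half of S = G - G^T, and gradsq = |S|^2; test
   the Lipschitz bound along the Cayley curve with velocity S. *)
Lemma gradsq_le_lipschitz (b l : R) c U : 0 <= l -> bm c ->
  (forall V W, SO V -> SO W -> `|pot mu b c V - pot mu b c W| <= l * nrm (V - W)) ->
  SO U -> gradsq mu b c U <= 4 * l ^+ 2.
Proof.
move=> l0 bc lc sU; have [_ [C cC]] := bc.
have C0 : 0 <= C by apply: le_trans (cC _ (SO_one n)).
pose G := gradm mu b c U; pose S := G - G^T.
have gE : gradsq mu b c U = nrm S ^+ 2.
  rewrite nrm_sqr -sum_ip_Xgen_sqr; apply: eq_bigr => p _.
  by rewrite (dpotE HHaar b (Xgen p) U bc).
have kS : S^T = - S by rewrite /S linearB /= trmxK opprB.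
have dS : dpot mu b c S U = nrm S ^+ 2 / 2.
  rewrite (dpotE HHaar b S U bc) -/G nrm_sqr [in X in _ = X / 2]/S ipBr.
  by rewrite -[ip S G^T]ip_tr trmxK kS ipNl; field.
have S0 := nrm_ge0 S.
have [K K0 HK] := pot_taylor HHaar b C0 (sqr_ge0 (nrm S)) S0.
have H : nrm S ^+ 2 / 2 <= l * nrm S.
  apply: (@le_of_inv_nat _ _ _ K) => m m0.
  have mR : 0 < m%:R :> R by rewrite ltr0n.
  pose t : R := m%:R^-1; have t0 : 0 < t by rewrite invr_gt0.
  have t1 : `|t| <= 1 by rewrite (ger0_norm (ltW t0)) invf_le1 // (ler_nat R 1).
  have [W [sW chord tang]] := SO_cayley t kS.
  have tg : tangent (nrm S ^+ 2) W S t by rewrite /tangent mulrC.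
  have := HK c U W S t bc cC sU sW t1 (lexx _) tg; rewrite dS.
  have := lc _ _ (SO_mul sW sU) sU.
  have -> : nrm (W *m U - U) = nrm (W - 1%:M).
    by rewrite -{2}(mul1mx U) -mulmxBl nrm_SOr.
  move=> h1; have {h1} := le_trans h1 (ler_wpM2l l0 chord).
  rewrite (ger0_norm (ltW t0)) -/t.
  move: (pot _ _ _ _) (pot _ _ _ _) (nrm S) => x y s.
  rewrite !ler_norml => /andP[_ h1] /andP[h2 _].
  rewrite -(ler_pM2l t0); lra.
rewrite gE (_ : 4 * l ^+ 2 = (2 * l) ^+ 2); last by ring.
rewrite lerXn2r ?nnegrE ?mulr_ge0 //.
have [->|s0] := eqVneq (nrm S) 0; first by rewrite mulr_ge0.
have sp : 0 < nrm S by rewrite lt0r s0.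
by rewrite -(ler_pM2r sp); move: H; move: (nrm S) => s; lra.
Qed.

Lemma nrm_le_entries U (h : R) : 0 <= h -> (forall i j, `|U i j| <= h) -> nrm U <= n%:R * h.
Proof.
move=> h0 Uh; rewrite -(@ler_pXn2r _ 2) ?nnegrE ?nrm_ge0 ?mulr_ge0 // nrm_sqr ipE.
apply: (@le_trans _ _ (\sum_(i < n) \sum_(j < n) h ^+ 2)).
  apply: ler_sum => i _; apply: ler_sum => j _.
  by rewrite -expr2 -real_normK ?num_real // lerXn2r ?nnegrE.
rewrite !sumr_const !card_ord -mulrnA -[leLHS]mulr_natl natrM.
by rewrite (_ : (n%:R * h) ^+ 2 = n%:R * n%:R * h ^+ 2) //; ring.
Qed.

(** Entries lie in [-n, n]. This range is cut at mesh h, and a representative in SO(n) is chosen for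
    each cell that meets SO(n), the identity standing for the others. Matrices in one cell are
    within n h <= delta; the n + 1 in [h] covers n = 0. *)
Lemma SO_net (delta : R) : 0 < delta -> exists (I : finType) (v : I -> 'M[R]_n),
  (forall i, SO (v i)) /\ forall V, SO V -> exists i, nrm (V - v i) <= delta.
Proof.
move=> d0.
pose h := delta / (n%:R + 1); have h0 : 0 < h by rewrite divr_gt0 // ltr_wpDl.
have [N [_ HN]] := exists_nat_gt (2 * n%:R / h).
pose cell V : {ffun 'I_n * 'I_n -> 'I_N.+1} :=
  [ffun p => inord (Num.truncn ((V p.1 p.2 + n%:R) / h))].
have rep (g : {ffun 'I_n * 'I_n -> 'I_N.+1}) :
    {W : 'M[R]_n | SO W /\ ((exists V, SO V /\ cell V = g) -> cell W = g)}.
  apply/cid; have [[V [sV cV]]|nV] := pselect (exists V, SO V /\ cell V = g).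
    by exists V.
  by exists 1%:M; split; [exact: SO_one|move/nV].
exists {ffun 'I_n * 'I_n -> 'I_N.+1}, (fun g => sval (rep g)).
split=> [g|V sV]; first by case: (svalP (rep g)).
exists (cell V); case: (svalP (rep (cell V))) => sW.
set W := sval _ in sW * => /(_ (ex_intro _ V (conj sV erefl))) cW.
have ent (X : 'M[R]_n) i j : SO X -> 0 <= (X i j + n%:R) / h <= N%:R.
  move=> sX; have : `|X i j| <= n%:R.
    rewrite -(ip_deltal i j X); apply: le_trans (ip_le_nrm _ _) _.
    have -> : nrm (@delta_mx R n n i j) = 1 by rewrite /nrm ip_deltal mxE !eqxx sqrtr1.
    by rewrite mul1r; apply: nrm_SO_le.
  rewrite ler_norml => /andP[x1 x2]; rewrite divr_ge0 ?(ltW h0) //=; last by lra.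
  by apply: le_trans HN; rewrite ler_wpM2r ?invr_ge0 ?(ltW h0) //; lra.
have trunc_lt (X : 'M[R]_n) i j : SO X -> (Num.truncn ((X i j + n%:R) / h) < N.+1)%N.
  move=> sX; have /andP[y0 yN] := ent X i j sX.
  by rewrite ltnS -(ler_nat R); apply: le_trans yN; rewrite truncn_le.
apply: (@le_trans _ _ (n%:R * h)); last first.
  by rewrite /h mulrA ler_pdivrMr ?ltr_wpDl // mulrC mulrDr mulr1 lerDl ltW.
apply: nrm_le_entries; first exact: ltW.
move=> i j; rewrite !mxE.
have /(congr1 val) : cell W (i, j) = cell V (i, j) by rewrite cW.
rewrite !ffunE /= !inordK ?trunc_lt // => e.
have /andP[v0 _] := ent V i j sV; have /andP[w0 _] := ent W i j sW.
have /andP[v1 v2] := truncn_itv v0; have /andP[w1 w2] := truncn_itv w0.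
rewrite e in w1 w2.
have -> : V i j - W i j = h * ((V i j + n%:R) / h - (W i j + n%:R) / h).
  by field; rewrite gt_eqF.
rewrite normrM (ger0_norm (ltW h0)) ler_piMr ?(ltW h0) //.
move: v1 v2 w1 w2; rewrite -natr1; move: (_ / h) (_ / h) (_%:R) => x y z.
by rewrite ler_norml => *; apply/andP; split; lra.
Qed.

Let bump (delta : R) V := Num.max 0 (delta - nrm (V - 1%:M)).

Let bm_bump delta : bm (bump delta).
Proof.
apply: lipschitz_SO_bm; exists 1 => U V _ _; rewrite mul1r /bump.
have h1 : nrm (U - 1%:M) <= nrm (V - 1%:M) + nrm (U - V).
  by rewrite [leRHS]addrC; apply: le_trans (nrmD _ _); rewrite addrA subrK.
have h2 : nrm (V - 1%:M) <= nrm (U - 1%:M) + nrm (U - V).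
  rewrite [leRHS]addrC -(nrmN (U - V)) opprB.
  by apply: le_trans (nrmD _ _); rewrite addrA subrK.
move: (nrm (U - 1%:M)) (nrm (V - 1%:M)) (nrm (U - V)) h1 h2 (nrm_ge0 (U - V)) => x y z h1 h2 z0.
rewrite ler_norml; apply/andP.
by case: (leP 0 (delta - x)) => ?; case: (leP 0 (delta - y)) => ?; split; lra.
Qed.

(** Over a net of mesh delta / 2, the left translates of the bump sum to at least delta / 2
    everywhere; they are finitely many and share one mean. Hence neighbourhoods of 1 have positive
    Haar mass. *)
Let mean_bump_gt0 delta : 0 < delta -> 0 < mean (bump delta).
Proof.
move=> d0; have d20 : 0 < delta / 2 by lra.
have [I [v [sv net]]] := SO_net d20.
have H : delta / 2 <= mean (fun V => \sum_i bump delta ((v i)^T *m V)).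
  rewrite -[leLHS](mean_cst HHaar).
  have bb i : bm (fun V => bump delta ((v i)^T *m V)).
    exact: bm_mulmxl (SO_tr (sv i)) (bm_bump delta).
  apply: (le_mean HHaar (bm_cst _) (bm_sum _ bb)) => V sV.
  have [i Vi] := net V sV.
  rewrite (bigD1 i) //=.
  have : delta / 2 <= bump delta ((v i)^T *m V).
    rewrite /bump le_max; apply/orP; right.
    have -> : (v i)^T *m V - 1%:M = (v i)^T *m (V - v i).
      by rewrite mulmxBr; case: (sv i) => -> _.
    by rewrite nrm_SOl; [lra|apply: SO_tr].
  have : 0 <= \sum_(j | j != i) bump delta ((v j)^T *m V).
    by apply: sumr_ge0 => j _; rewrite /bump le_max lexx.
  move: (bump _ _) (\sum_(j | _) _) => x y; lra.
have E : mean (fun V => \sum_i bump delta ((v i)^T *m V)) = \sum_(i : I) mean (bump delta).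
  rewrite (mean_sum HHaar).
    by apply: eq_bigr => i _; exact: (mean_mulmxl HHaar (SO_tr (sv i)) (bm_bump delta)).
  by move=> i; exact: bm_mulmxl (SO_tr (sv i)) (bm_bump delta).
rewrite E sumr_const in H.
rewrite ltNge; apply/negP => m0.
by have := le_trans H (mulrn_wle0 _ m0); rewrite leNgt d20.
Qed.

Lemma nrm_sub_one_sqr V : SO V -> nrm (V - 1%:M) ^+ 2 = 2 * n%:R - 2 * ip 1%:M V.
Proof.
move=> sV; rewrite nrm_sqr !(ipBl, ipBr) (ip_SO sV) (ip_SO (SO_one n)) (ipC V); ring.
Qed.

Let bm_nrm1 : bm (fun V => nrm (V - 1%:M)).
Proof.
apply: lipschitz_SO_bm; exists 1 => U V _ _; rewrite mul1r ler_norml.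
have h1 : nrm (U - 1%:M) <= nrm (V - 1%:M) + nrm (U - V).
  by rewrite [leRHS]addrC; apply: le_trans (nrmD _ _); rewrite addrA subrK.
have h2 : nrm (V - 1%:M) <= nrm (U - 1%:M) + nrm (U - V).
  rewrite [leRHS]addrC -(nrmN (U - V)) opprB.
  by apply: le_trans (nrmD _ _); rewrite addrA subrK.
by apply/andP; split; lra.
Qed.

(** By |V - 1|^2 = 2 n - 2 <1, V> the kernel is exp (b (n - |V - 1|^2 / 2)), which concentrates at 1
    for large b. Points with |V - 1| <= eta / 2 contribute at most half of the bound, and b makes
    the others contribute no more. *)
Lemma kernel_concentration (eta : R) : 0 < eta -> exists b : R,
  0 < mean (ker b 1%:M) /\
  mean (fun V => nrm (V - 1%:M) * ker b 1%:M V) <= eta * mean (ker b 1%:M).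
Proof.
move=> e0; pose delta := eta / 4; have d0 : 0 < delta by rewrite divr_gt0.
pose p := mean (bump delta) / delta.
have p0 : 0 < p by rewrite divr_gt0 // mean_bump_gt0.
(* [E1] bounds the kernel beyond distance eta / 2, and [E2] bounds it from below within delta = eta
   / 4. Their ratio exp (3 b eta^2 / 32) must reach 4 n / (eta p); 1 + x <= exp x reduces this to
   the chosen b. *)
pose b := (4 * n%:R / (eta * p)) * (32 / (3 * eta ^+ 2)).
have b0 : 0 <= b.
  have ep : 0 <= eta * p by apply: mulr_ge0; apply: ltW.
  by rewrite /b; apply: mulr_ge0; apply: divr_ge0 => //; rewrite mulr_ge0 ?sqr_ge0.
exists b; pose E1 := expR (b * (n%:R - eta ^+ 2 / 8)).
pose E2 := expR (b * (n%:R - eta ^+ 2 / 32)).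
have bk := bm_ker b (1%:M : 'M[R]_n).
have Z : p * E2 <= mean (ker b 1%:M).
  rewrite /p mulrAC -mulrA mulrC -(meanZ HHaar); last exact: bm_bump.
  apply: (le_mean HHaar (bmZ _ (bm_bump delta)) bk) => V sV.
  have n2 := nrm_sub_one_sqr sV; rewrite /bump.
  case: (leP 0 (delta - nrm (V - 1%:M))) => dV; last by rewrite mulr0 expR_ge0.
  have x0 := nrm_ge0 (V - 1%:M).
  apply: (@le_trans _ _ E2).
    by rewrite -mulrA ler_piMr ?expR_ge0 // mulrC ler_pdivrMr // mul1r; lra.
  rewrite ler_expR ler_wpM2l //.
  have : nrm (V - 1%:M) ^+ 2 <= delta ^+ 2 by rewrite lerXn2r ?nnegrE ?(ltW d0) //; lra.
  by rewrite n2 /delta; move: (ip _ _) => y; lra.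
have E20 : 0 < E2 by apply: expR_gt0.
have Z0 : 0 < mean (ker b 1%:M) by apply: lt_le_trans Z; rewrite mulr_gt0.
split=> //.
have key : 2 * n%:R * E1 <= eta / 2 * (p * E2).
  have E12 : E2 = E1 * expR (b * (3 * eta ^+ 2 / 32)).
    by rewrite -expRD; congr expR; field.
  have : 4 * n%:R / (eta * p) <= expR (b * (3 * eta ^+ 2 / 32)).
    apply: le_trans (expR_ge1Dx _); rewrite /b.
    have -> : 4 * n%:R / (eta * p) * (32 / (3 * eta ^+ 2)) * (3 * eta ^+ 2 / 32)
       = 4 * n%:R / (eta * p) by field; rewrite !gt_eqF.
    by rewrite lerDr.
  rewrite ler_pdivrMr; last exact: mulr_gt0.
  rewrite E12; move: (expR (b * (3 * eta ^+ 2 / 32))) => x hx.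
  have : E1 * (4 * n%:R) <= E1 * (x * (eta * p)) by rewrite ler_wpM2l ?expR_ge0.
  lra.
apply: (@le_trans _ _ (mean (fun V => eta / 2 * ker b 1%:M V + 2 * n%:R * E1))).
  apply: (le_mean HHaar (bmM bm_nrm1 bk) (bmD (bmZ _ bk) (bm_cst _))) => V sV.
  have n2 := nrm_sub_one_sqr sV; have x0 := nrm_ge0 (V - 1%:M).
  have k0 : 0 <= ker b 1%:M V by apply: expR_ge0.
  have E10 : 0 <= E1 by apply: expR_ge0.
  have xn := nrm_sub_SO_le sV (SO_one n).
  have [le|gt] := leP (nrm (V - 1%:M)) (eta / 2).
    apply: (@le_trans _ _ (eta / 2 * ker b 1%:M V)); first by rewrite ler_wpM2r.
    by rewrite lerDl !mulr_ge0.
  apply: (@le_trans _ _ (2 * n%:R * E1)); last by rewrite lerDr mulr_ge0 // ltW // divr_gt0.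
  apply: ler_pM => //; rewrite ler_expR ler_wpM2l //.
  have : (eta / 2) ^+ 2 <= nrm (V - 1%:M) ^+ 2.
    by rewrite lerXn2r ?nnegrE ?divr_ge0 ?(ltW e0) // ltW.
  by rewrite n2; move: (ip _ _) => y; lra.
rewrite (meanD HHaar (bmZ _ bk) (bm_cst _)) (mean_cst HHaar) (meanZ HHaar _ bk).
have := ler_wpM2l (_ : 0 <= eta / 2) Z; move: key.
move: (mean _) (p * E2) (_ * E1) => x y z key /(_ ltac:(lra)); lra.
Qed.

Lemma mean_norm_le_mean (f g : 'M[R]_n -> R) : bm f -> bm g ->
  (forall V, SO V -> `|f V| <= g V) -> `|mean f| <= mean g.
Proof.
move=> bf bg fg; have bg' := bmZ (-1) bg.
rewrite ler_norml; apply/andP; split.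
  rewrite -mulN1r -(meanZ HHaar _ bg); apply: (le_mean HHaar bg' bf) => V sV.
  by have := fg V sV; rewrite ler_norml mulN1r => /andP[].
apply: (le_mean HHaar bf bg) => V sV.
by have := fg V sV; rewrite ler_norml => /andP[].
Qed.

(** Written as the mean of c (U V) against the kernel at (1, V), mollification averages right
    translates of F, so it keeps the Lipschitz constant: |U V - W V| = |U - W|. It moves F by at
    most l eta, once in the mean and once in the exponent, whence the error 2 lam l / j. *)
Lemma mgf_lipschitz (l lam : R) F : (2 < n)%N -> 0 <= l -> 0 <= lam ->
  (forall U V, SO U -> SO V -> `|F U - F V| <= l * nrm (U - V)) ->
  mean (fun U => expR (lam * F U)) <=
  expR (lam * mean F + 2 * lam ^+ 2 * l ^+ 2 / (n%:R - 2)).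
Proof.
move=> n3 l0 lam0 lF.
have bF : bm F by apply: lipschitz_SO_bm; exists l.
pose beta := 2 * lam ^+ 2 * l ^+ 2 / (n%:R - 2).
suff H (j : nat) : (0 < j)%N -> mean (fun U => expR (lam * F U)) <=
    expR (lam * mean F + beta + 2 * lam * l / j%:R).
  move: H; rewrite -/beta; move: (mean _) (lam * _ + beta) => x y H.
  have [x0|x0] := leP x 0; first exact: le_trans x0 (expR_ge0 _).
  rewrite -(lnK x0) ler_expR; apply: (@le_of_inv_nat _ _ _ (2 * lam * l)) => j j0.
  by rewrite -ler_expR lnK //; apply: H.
move=> j0; pose eta : R := j%:R^-1.
have eta0 : 0 < eta by rewrite invr_gt0 ltr0n.
have [b [Z0 Zeta]] := kernel_concentration eta0.
set Z := mean (ker b 1%:M) in Z0 Zeta.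
have bk := bm_ker b (1%:M : 'M[R]_n).
(* Division by [Z] turns the kernel into a probability density. *)
pose c V := Z^-1 * F V.
have bc : bm c := bmZ Z^-1 bF.
have bcU U : SO U -> bm (fun V => c (U *m V)) by move=> sU; exact: bm_mulmxl sU bc.
have pE U : SO U -> pot mu b c U = mean (fun V => c (U *m V) * ker b 1%:M V).
  by move=> sU; rewrite -[in LHS](mulmx1 U) -(pot_mulmxl HHaar b 1%:M sU bc).
have pL U W : SO U -> SO W -> `|pot mu b c U - pot mu b c W| <= l * nrm (U - W).
  move=> sU sW; rewrite (pE U sU) (pE W sW).
  rewrite -(meanB HHaar (bmM (bcU U sU) bk) (bmM (bcU W sW) bk)).
  have E : mean (fun V => Z^-1 * (l * nrm (U - W)) * ker b 1%:M V) = l * nrm (U - W).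
    by rewrite (meanZ HHaar _ bk) -/Z mulrAC mulVf ?gt_eqF // mul1r.
  rewrite -E; apply: mean_norm_le_mean.
  - exact: bmB (bmM (bcU U sU) bk) (bmM (bcU W sW) bk).
  - exact: bmZ.
  move=> V sV; rewrite -mulrBl normrM (ger0_norm (expR_ge0 _)) ler_wpM2r ?expR_ge0 //.
  rewrite /c -mulrBr normrM ger0_norm ?invr_ge0 ?(ltW Z0) // ler_wpM2l ?invr_ge0 ?(ltW Z0) //.
  rewrite -(nrm_SOr (U - W) sV) mulmxBl; apply: lF; exact: SO_mul.
have pF U : SO U -> `|pot mu b c U - F U| <= l * eta.
  move=> sU; rewrite (pE U sU).
  have E : F U = mean (fun V => Z^-1 * F U * ker b 1%:M V).
    by rewrite (meanZ HHaar _ bk) -/Z mulrAC mulVf ?gt_eqF // mul1r.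
  have bE : bm (fun V => Z^-1 * F U * ker b 1%:M V) by exact: bmZ.
  rewrite [X in _ - X]E -(meanB HHaar (bmM (bcU U sU) bk) bE).
  have bn : bm (fun V => nrm (V - 1%:M) * ker b 1%:M V) by exact: bmM bm_nrm1 bk.
  apply: (@le_trans _ _ (mean (fun V => Z^-1 * l * (nrm (V - 1%:M) * ker b 1%:M V)))).
    apply: mean_norm_le_mean.
    - exact: bmB (bmM (bcU U sU) bk) bE.
    - exact: bmZ.
    move=> V sV; rewrite -mulrBl normrM (ger0_norm (expR_ge0 _)) mulrA.
    rewrite ler_wpM2r ?expR_ge0 // /c -mulrBr normrM ger0_norm ?invr_ge0 ?(ltW Z0) //.
    rewrite -mulrA ler_wpM2l ?invr_ge0 ?(ltW Z0) //.
    rewrite -(nrm_SOl (V - 1%:M) sU) mulmxBr mulmx1; apply: lF => //; exact: SO_mul.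
  rewrite (meanZ HHaar _ bn).
  have : Z^-1 * l * mean (fun V => nrm (V - 1%:M) * ker b 1%:M V) <= Z^-1 * l * (eta * Z).
    by rewrite ler_wpM2l // mulr_ge0 // invr_ge0 ltW.
  move=> /le_trans; apply; rewrite le_eqVlt; apply/orP; left; apply/eqP.
  by move: (Z) Z0 => z z0; field; rewrite gt_eqF.
have bp := bm_pot HHaar b bc.
have gq U : SO U -> gradsq mu b c U <= 4 * l ^+ 2.
  by move=> sU; exact: gradsq_le_lipschitz l0 bc pL sU.
have mb := mgf_bound HHaar n3 lam0 bc gq.
have mF : mean (pot mu b c) <= mean F + l * eta.
  have -> : mean F + l * eta = mean (fun U => F U + l * eta).
    by rewrite (meanD HHaar bF (bm_cst _)) (mean_cst HHaar).
  apply: (le_mean HHaar bp (bmD bF (bm_cst _))) => U sU.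
  by rewrite -lerBlDl; apply: le_trans (ler_norm _) (pF U sU).
have be := bm_exp (bmZ lam bp).
apply: (@le_trans _ _ (expR (lam * (l * eta)) * mean (fun U => expR (lam * pot mu b c U)))).
  rewrite -(meanZ HHaar _ be); apply: (le_mean HHaar (bm_exp (bmZ lam bF)) (bmZ _ be)) => U sU.
  rewrite -expRD ler_expR -mulrDr ler_wpM2l //.
  by rewrite -lerBlDr; apply: le_trans (ler_norm _) _; rewrite distrC; apply: pF.
apply: le_trans (ler_wpM2l (expR_ge0 _) mb) _; rewrite -expRD ler_expR.
have := ler_wpM2l lam0 mF; rewrite -/eta.
have -> : lam ^+ 2 * (4 * l ^+ 2) / (2 * (n%:R - 2)) = beta.
  have : 0 < n%:R - 2 :> R by rewrite subr_gt0 (ltr_nat R 2).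
  by rewrite /beta; move: (n%:R - 2) => nu nu0; field; rewrite gt_eqF.
move: (mean _) (mean _) => x y; lra.
Qed.

End Mollification.

(** * The distance to a nonempty set as a real 1-Lipschitz function *)

Section DistanceToSet.
Context {R : realType} {X : Type}.
Variables (dist : X -> X -> R) (Hmetric : is_metric dist) (A : set X) (y0 : X) (Ay0 : A y0).

Lemma dist_set_fin x : (fine (dist_set dist A x))%:E = dist_set dist A x.
Proof.
apply/fineK/fin_numPlt/andP; split.
  apply: (@lt_le_trans _ _ 0%E); first exact: ltNyr.
  by apply: le_ereal_inf_tmp => _ [y _ <-]; rewrite lee_fin; case: Hmetric.
apply: (@le_lt_trans _ _ (dist y0 x)%:E); last exact: ltry.
by apply: ereal_inf_lbound; exists y0.
Qed.

Lemma dist_set_le y x : A y -> fine (dist_set dist A x) <= dist y x.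
Proof.
by move=> Ay; rewrite -lee_fin dist_set_fin; apply: ereal_inf_lbound; exists y.
Qed.

Lemma dist_set_ge r x : (forall y, A y -> r <= dist y x) -> r <= fine (dist_set dist A x).
Proof.
move=> H; rewrite -lee_fin dist_set_fin; apply: le_ereal_inf_tmp => _ [y Ay <-].
by rewrite lee_fin H.
Qed.

Lemma dist_set_ge0 x : 0 <= fine (dist_set dist A x).
Proof. by apply: dist_set_ge => y _; case: Hmetric. Qed.

Lemma dist_set_eq0 x : A x -> fine (dist_set dist A x) = 0.
Proof.
move=> Ax; apply/eqP; rewrite eq_le dist_set_ge0 andbT.
by have := dist_set_le x Ax; have [_ d0 _ _] := Hmetric; rewrite (d0 x x).2.
Qed.

Lemma dist_set_lipschitz x y :
  `|fine (dist_set dist A x) - fine (dist_set dist A y)| <= dist x y.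
Proof.
have H u v : fine (dist_set dist A u) - dist u v <= fine (dist_set dist A v).
  apply: dist_set_ge => z Az; rewrite lerBlDr.
  apply: le_trans (dist_set_le u Az) _; have [_ _ dC dT] := Hmetric.
  by rewrite (dC u v); apply: dT.
have h1 := H x y; have := H y x; have [_ _ -> _] := Hmetric => h2.
by rewrite ler_norml; apply/andP; split; lra.
Qed.

End DistanceToSet.

(** * Measurability of the orbit map *)

Section OrbitMap.
Context {R : realType} {n : nat} {X : Type}.
Local Notation M := (MBorel R n).
Variables (dist : X -> X -> R) (act : 'M[R]_n -> X -> X) (L : R) (x0 : X).
Hypothesis L0 : 0 < L.
Hypothesis HLip : SO_Lipschitz_action dist act L.
Hypothesis Hmetric : is_metric dist.

(** The orbit map is controlled on SO(n) alone, so the preimage is SO(n) cut by an open set of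
    matrices: a union of balls around points V of SO(n), of radius e / L when G contains the e-ball
    around V x0. *)
Lemma orbit_preimage_open (G : set X) : dist_open dist G ->
  measurable ([set U | SO U /\ G (act U x0)] : set M).
Proof.
move=> oG.
pose G' : set M := [set W : 'M[R]_n | exists V e, [/\ SO V, L * nrm (V - W) < e &
  forall y, dist (act V x0) y < e -> G y]].
have -> : [set U | SO U /\ G (act U x0)] = @SO R n `&` G'.
  apply/seteqP; split => U /= [sU].
    move=> /oG [e e0 He]; split=> //; exists U, e; split => //.
    by rewrite subrr /nrm ip0l sqrtr0 mulr0.
  move=> [V [e [sV VU He]]]; split => //; apply: He.
  by apply: le_lt_trans VU; rewrite -frob_distE; apply: HLip.
apply: measurableI; first exact: measurable_SO.
apply: measurable_frob_open => W [V [e [sV VW He]]].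
exists ((e - L * nrm (V - W)) / L); first by rewrite divr_gt0 // subr_gt0.
move=> W'; rewrite frob_distE ltr_pdivlMr // => WW'; exists V, e; split => //.
have : nrm (V - W') <= nrm (V - W) + nrm (W - W').
  by apply: le_trans (nrmD _ _); rewrite addrA subrK.
by move: WW'; move: (nrm (V - W')) (nrm (V - W)) (nrm (W - W')) => a b c ? /(ler_wpM2l (ltW L0)); lra.
Qed.

Lemma orbit_preimage_measurable (A : set X) : <<s dist_open dist >> A ->
  measurable ([set U | SO U /\ A (act U x0)] : set M).
Proof.
move: A; pose P : set (set X) :=
  fun A => measurable ([set U | SO U /\ A (act U x0)] : set M).
suff : <<s dist_open dist >> `<=` P by [].
apply: smallest_sub; last by move=> G /orbit_preimage_open.
split.
- rewrite /P (_ : [set U | _] = set0); first exact: measurable0.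
  by apply/seteqP; split => U // [].
- move=> B mB; rewrite /P.
  have -> : [set U | SO U /\ (setT `\` B) (act U x0)]
    = @SO R n `\` [set U | SO U /\ B (act U x0)].
    apply/seteqP; split => U /= [sU]; first by move=> [_ nB]; split => // -[].
    by move=> nB; split => //; split => // BU; apply: nB.
  by apply: measurableD => //; exact: measurable_SO.
- move=> B mB; rewrite /P.
  have -> : [set U | SO U /\ (\bigcup_k B k) (act U x0)]
    = \bigcup_k [set U | SO U /\ B k (act U x0)].
    apply/seteqP; split => U /=; first by move=> [sU [k _ Bk]]; exists k.
    by move=> [k _ [sU Bk]]; split => //; exists k.
  by apply: bigcup_measurable => k _; apply: mB.
Qed.

End OrbitMap.

(** * The concentration inequality on X *)

Theorem theorem4 (R : realType) (d : nat)
  (mu : probability (MBorel R d) R) (HHaar : is_Haar_SO mu)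
  (X : Type) (dist : X -> X -> R) (act : 'M[R]_d -> X -> X)
  (Hmetric : is_metric dist)
  (HSO : SO_metric_space dist act)
  (Htrans : SO_transitive act)
  (L : R) (HL : 0 < L) (HLip : SO_Lipschitz_action dist act L)
  (x0 : X)
  (A : set X) (HA : <<s dist_open dist >> A)
  (eps : R) (Heps : 0 < eps) :
  ((1 - expR (- ((d%:R - 2) * eps ^+ 2 * (fine (mu_X mu act x0 A)) ^+ 2)
                / (8 * L ^+ 2)))%:E
     <= mu_X mu act x0 (enlarge dist A eps))%E.
Proof.
have eps0 := ltW Heps.
pose SA : set (MBorel R d) := [set U | SO U /\ A (act U x0)].
have mSA : measurable SA by apply: (orbit_preimage_measurable x0 HL HLip).
have muA : mu_X mu act x0 A = mu SA by [].
rewrite muA; set a := fine (mu SA).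
have a0 : 0 <= a by apply: fine_ge0.
(* With a nonnegative exponent the left side is at most 0. This settles d <= 2 and a = 0, leaving d
   - 2 > 0 and A nonempty. *)
have trivial_case : 0 <= - ((d%:R - 2) * eps ^+ 2 * a ^+ 2) / (8 * L ^+ 2) ->
  ((1 - expR (- ((d%:R - 2) * eps ^+ 2 * a ^+ 2) / (8 * L ^+ 2)))%:E
     <= mu_X mu act x0 (enlarge dist A eps))%E.
  move=> h; apply: (@le_trans _ _ 0%E); last exact: measure_ge0.
  by rewrite lee_fin subr_le0 -[leLHS]expR0 ler_expR.
have [d2|d3] := leqP d 2.
  apply: trivial_case; apply: divr_ge0; last by rewrite mulr_ge0 ?sqr_ge0.
  rewrite oppr_ge0 -mulrA mulr_le0_ge0 ?mulr_ge0 ?sqr_ge0 // subr_le0.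
  by rewrite (ler_nat R d 2).
have [az|anz] := eqVneq a 0.
  by apply: trivial_case; rewrite az expr0n /= mulr0 oppr0 mul0r.
have ap : 0 < a by rewrite lt0r anz.
have [y0 Ay0] : exists y, A y.
  apply: contrapT => nA; move/eqP: anz; apply; rewrite /a (_ : SA = set0) ?measure0 //.
  by apply/seteqP; split => U // -[_ AU]; apply: nA; exists (act U x0).
pose D (U : 'M[R]_d) := fine (dist_set dist A (act U x0)).
(* Truncation at eps keeps the Lipschitz constant and controls the mean: F is 0 where U x0 is in A
   and at most eps elsewhere. *)
pose F (U : 'M[R]_d) := Num.min (D U) eps.
have lD U V : SO U -> SO V -> `|D U - D V| <= L * nrm (U - V).
  move=> sU sV; apply: le_trans (dist_set_lipschitz Hmetric Ay0 _ _) _.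
  by rewrite -frob_distE; apply: HLip.
have lF U V : SO U -> SO V -> `|F U - F V| <= L * nrm (U - V).
  move=> sU sV; apply: le_trans (lD U V sU sV); rewrite /F.
  move: (D U) (D V) => x y; rewrite ler_norml.
  have := ler_norm (y - x); rewrite (distrC y x); have := ler_norm (x - y).
  move: `|x - y| => z h1 h2; apply/andP.
  by case: (leP x eps) => ?; case: (leP y eps) => ?; split; lra.
have bF : bm F by apply: lipschitz_SO_bm; exists L.
pose E : set (MBorel R d) := [set U | SO U /\ enlarge dist A eps (act U x0)].
have EE : E = @SO R d `&` D @^-1` `]-oo, eps]%classic.
  apply/seteqP; split => U /= [sU]; rewrite in_itv /= /enlarge /=.
    by rewrite -(dist_set_fin Hmetric Ay0) lee_fin.
  by rewrite -lee_fin (dist_set_fin Hmetric Ay0).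
have mE : measurable E.
  have mD : measurable_fun (@SO R d : set (MBorel R d)) (D : MBorel R d -> R).
    by apply: lipschitz_SO_measurable; exists L.
  by rewrite EE; apply: mD; [exact: measurable_SO|exact: measurable_itv].
pose m := mean mu F.
have mF : m <= eps * (1 - a).
  have -> : eps * (1 - a) = mean mu (fun U => eps - eps * \1_SA U).
    rewrite (meanB HHaar (bm_cst _) (bmZ _ (bm_indic mSA))) (mean_cst HHaar).
    rewrite (meanZ HHaar _ (bm_indic mSA)) mean_indic //; last by move=> U [].
    by rewrite mulrBr mulr1.
  apply: (le_mean HHaar bF (bmB (bm_cst _) (bmZ _ (bm_indic mSA)))) => U sU.
  rewrite indicE /F; have [/set_mem [_ AU]|_] := boolP (U \in SA).
    by rewrite /D (dist_set_eq0 Hmetric AU) // mulr1 subrr ge_min lexx.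
  by rewrite mulr0 subr0 ge_min lexx orbT.
pose nu : R := d%:R - 2.
have nu0 : 0 < nu by rewrite subr_gt0 (ltr_nat R 2).
(* The minimiser of - lam eps a + 2 lam^2 L^2 / nu, with minimum - nu eps^2 a^2 / (8 L^2). *)
pose lam := eps * a * nu / (4 * L ^+ 2).
have lam0 : 0 <= lam.
  by rewrite divr_ge0 ?mulr_ge0 ?sqr_ge0 // ltW.
have be := bm_exp (bmZ lam bF).
have chernoff : 1 - fine (mu E) <= expR (- (lam * eps)) * mean mu (fun U => expR (lam * F U)).
  have -> : 1 - fine (mu E) = mean mu (fun U => 1 - \1_E U).
    rewrite (meanB HHaar (bm_cst _) (bm_indic mE)) (mean_cst HHaar).
    by rewrite mean_indic // => U [].
  rewrite -(meanZ HHaar _ be).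
  apply: (le_mean HHaar (bmB (bm_cst _) (bm_indic mE)) (bmZ _ be)) => U sU.
  rewrite indicE; have [_|nE] := boolP (U \in E).
    by rewrite subrr mulr_ge0 ?expR_ge0.
  have -> : F U = eps.
    rewrite /F min_r // ltW // ltNge; apply/negP => DU.
    by move/negP: nE; apply; apply/mem_set; rewrite EE; split => //=; rewrite in_itv.
  by rewrite subr0 -expRD addNr expR0.
have mg := mgf_lipschitz HHaar d3 (ltW HL) lam0 lF.
have muE : mu_X mu act x0 (enlarge dist A eps) = (fine (mu E))%:E.
  by rewrite fineK //; apply: fin_num_measure.
rewrite muE lee_fin lerBlDr -lerBlDl.
apply: le_trans chernoff _.
apply: le_trans (ler_wpM2l (expR_ge0 _) mg) _.
rewrite -expRD ler_expR -/m -/nu.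
have h := ler_wpM2l lam0 mF.
have -> : - (nu * eps ^+ 2 * a ^+ 2) / (8 * L ^+ 2)
  = - (lam * eps) + (lam * (eps * (1 - a)) + 2 * lam ^+ 2 * L ^+ 2 / nu).
  rewrite /lam; move: (nu) nu0 (a) => v v0 w; field.
  by rewrite !gt_eqF.
by rewrite lerD2l lerD2r.
Qed.
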